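(* (A) Let $P$ be a partition of $S_3$. Then there exists a straightening set $C$ of $P$ such that $P$ is $C$-confluent. (B) If moreover $123$, $132$, $213$ are not all in the same part of $P$, and $321$, $312$, $231$ are not all in the same part of $P$, then for every $n\ge3$ the number of equivalence classes of $S_n$ under the $P$-equivalence equals $$\sum_{j\ge0,\ 3j\le n}\frac{(-1)^j\,((n-2j)!)^2\,k^j}{j!\,(n-3j)!},\qquad k=6-|P|,$$ where $|P|$ is the number of parts of $P$.
   Context: Here $c=3$. $S_m$ is the set of permutations of $\{1,\dots,m\}$ written as words. A word $w_1w_2w_3$ (distinct integer letters) forms $u\in S_3$ if there is an integer $k$ with $w_i=u_i+k$ for all $i$. A hit in $w\in S_n$ is a contiguous subword of length $3$ forming some $u\in S_3$. For a partition $P$ of a subset of $S_3$, a $P$-hit is a hit forming a permutation in some part of $P$; a $P$-rearrangement rearranges the letters of a $P$-hit in place so that the new subword forms a permutation in the same part of $P$. The $P$-equivalence on $S_n$ is the reflexive-transitive closure of $P$-rearrangement. Tail size of a word $w$ of length $m$ with distinct letters: least $k\ge1$ such that the first $k$ letters are the $k$ smallest letters of $w$. $w$ is right leaning if its tail size is $<m$, left leaning if its reversal has tail size $<m$, omni leaning if neither. Polarization of a hit $h$ in $w\in S_n$: if $h$ is all of $w$, $h$ is left polarized. Otherwise let $a$ be the average of the letters of $h$, $w'$ be $w$ with $h$ replaced by the single letter $a$, and $b$ the letter adjacent to $a$ in $w'$ closest in value to $a$ (ties: the left one). If $a,b$ appear in increasing order in $w'$, $h$ is right polarized; if decreasing,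 left polarized. A hit is backward if it is right polarized and left leaning, or left polarized and right leaning, or omni leaning; otherwise forward. A straightening set $C$ of $P$ is a set of permutations from the parts of $P$ containing exactly: one left leaning permutation from each part containing a left leaning permutation, one right leaning permutation from each part containing a right leaning permutation, and one permutation from each part containing only omni leaning permutations. A $P$-hit $h$ is $(P,C)$-straightened if it forms a permutation in $C$ and either it is forward, or it is backward and no $P$-rearrangement of $h$ makes it forward. $(P,C)$-straightening a $P$-hit means applying a $P$-rearrangement so it becomes $(P,C)$-straightened. The $(P,C)$-straightening operator $\to$ on $S_n$: $w\to w'$ iff $w'$ is obtained from $w$ by $(P,C)$-straightening a not-yet-$(P,C)$-straightened $P$-hit of $w$. A relation $\to$ on a finite set $A$ with reflexive-transitive closure $\to'$ is confluent if there are no distinct $a,b$ with $a\to'b$ and $b\to'a$, and each connected component $K$ of $(A,\to)$ has a unique node $m$ with $x\to'm$ for all $x\in K$. $P$ is $C$-confluent if the $(P,C)$-straightening operator on $S_n$ is confluent. *)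

(* Defs.v *)
From mathcomp Require Import all_boot all_order all_fingroup all_algebra.

Set Implicit Arguments.
Unset Strict Implicit.
Unset Printing Implicit Defensive.

(* A permutation written as a word in the letters 1, ..., n; 'S_n itself acts
   on 0, ..., n - 1. *)
Definition word (n : nat) (w : 'S_n) : seq nat :=
  [seq (val (w i)).+1 | i <- enum 'I_n].

(* Letters of permutations are at least 1, so the shift k from u to h is never
   negative, and it is smaller than every letter of h; the bound on k only
   serves to make the quantifier decidable (see formsP). *)
Definition forms (h : seq nat) (u : 'S_3) : bool :=
  [exists k : 'I_(sumn h).+1, h == [seq x + k | x <- word u]].

Lemma formsP (h : seq nat) (u : 'S_3) :
  reflect (exists k : nat, h = [seq x + k | x <- word u]) (forms h u).
Proof.
apply: (iffP existsP) => [[k /eqP h_k]|[k h_k]]; first by exists k.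
have lt_k : k < (sumn h).+1.
  rewrite ltnS h_k /word enum_ordSl /=.
  by apply: leq_trans (leq_addr _ _); apply: leq_addl.
by exists (Ordinal lt_k); rewrite {1}h_k.
Qed.

(* The k smallest letters of w are the first k entries of its sorted version. *)
Definition tail_size (w : seq nat) : nat :=
  (find (fun k => perm_eq (take k w) (take k (sort leq w)))
        (iota 1 (size w))).+1.

Definition right_leaning (w : seq nat) : bool := tail_size w < size w.
Definition left_leaning (w : seq nat) : bool := tail_size (rev w) < size w.
Definition omni_leaning (w : seq nat) : bool :=
  ~~ right_leaning w && ~~ left_leaning w.

(* Hits are designated by their (0-based) starting position i in w. *)
Definition factor3 (w : seq nat) (i : nat) : seq nat := take 3 (drop i w).

(* Only meaningful when factor3 w i is a hit: its letters are then three
   consecutive integers, so that the division defining their average a is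
   exact. When the hit is all of w, a has no neighbour and the result is false,
   i.e. the hit is left polarized. *)
Definition right_polarized (w : seq nat) (i : nat) : bool :=
  let a := sumn (factor3 w i) %/ 3 in
  let w' := take i w ++ a :: drop (i + 3) w in
  let dist x := (x - a) + (a - x) in
  let l := nth 0 w' i.-1 in
  let r := nth 0 w' i.+1 in
  let has_l := 0 < i in
  let has_r := i.+1 < size w' in
  if has_l && (~~ has_r || (dist l <= dist r)) then l < a
  else if has_r then a < r
  else false.

Definition left_polarized (w : seq nat) (i : nat) : bool :=
  ~~ right_polarized w i.

Definition backward (w : seq nat) (i : nat) : bool :=
  [|| right_polarized w i && left_leaning (factor3 w i),
      left_polarized w i && right_leaning (factor3 w i)
    | omni_leaning (factor3 w i)].

Definition forward (w : seq nat) (i : nat) : bool := ~~ backward w i.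

Definition P_hit (P : {set {set 'S_3}}) (n : nat) (w : 'S_n) (i : nat) : bool :=
  [exists Q in P, exists u in Q, forms (factor3 (word w) i) u].

Definition P_rearrangement_at (P : {set {set 'S_3}}) (n : nat) (i : nat)
    (w w' : 'S_n) : bool :=
  [&& take i (word w') == take i (word w),
      drop (i + 3) (word w') == drop (i + 3) (word w),
      perm_eq (factor3 (word w') i) (factor3 (word w) i)
    & [exists Q in P, exists u in Q, exists u' in Q,
        forms (factor3 (word w) i) u && forms (factor3 (word w') i) u']].

Definition P_rearrangement (P : {set {set 'S_3}}) (n : nat) : rel 'S_n :=
  fun w w' => [exists i : 'I_n, P_rearrangement_at P i w w'].

Definition P_equiv (P : {set {set 'S_3}}) (n : nat) : rel 'S_n :=
  connect (@P_rearrangement P n).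

Definition P_classes (P : {set {set 'S_3}}) (n : nat) : {set {set 'S_n}} :=
  equivalence_partition (@P_equiv P n) [set: 'S_n].

(* The booleans on the right-hand sides are coerced to the numbers 0 and 1. *)
Definition straightening_set (P : {set {set 'S_3}}) (C : {set 'S_3}) : Prop :=
  C \subset cover P /\
  forall Q : {set 'S_3}, Q \in P ->
    [/\ #|[set u in C :&: Q | left_leaning (word u)]|
          = [exists u in Q, left_leaning (word u)] :> nat,
        #|[set u in C :&: Q | right_leaning (word u)]|
          = [exists u in Q, right_leaning (word u)] :> nat
      & #|[set u in C :&: Q | omni_leaning (word u)]|
          = [forall u in Q, omni_leaning (word u)] :> nat].

Definition straightened (P : {set {set 'S_3}}) (C : {set 'S_3}) (n : nat)
    (w : 'S_n) (i : nat) : bool :=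
  [&& P_hit P w i,
      [exists u in C, forms (factor3 (word w) i) u]
    & forward (word w) i
      || backward (word w) i
         && ~~ [exists w' : 'S_n,
                 P_rearrangement_at P i w w' && forward (word w') i]].

Definition straightening (P : {set {set 'S_3}}) (C : {set 'S_3}) (n : nat) :
    rel 'S_n :=
  fun w w' => [exists i : 'I_n,
    [&& P_hit P w i, ~~ straightened P C w i,
        P_rearrangement_at P i w w' & straightened P C w' i]].

Definition components (T : finType) (e : rel T) : {set {set T}} :=
  equivalence_partition (connect [rel x y | e x y || e y x]) [set: T].

Definition confluent (T : finType) (e : rel T) : Prop :=
  (forall a b : T, a != b -> ~ (connect e a b /\ connect e b a)) /\
  (forall K : {set T}, K \in components e ->
     exists! m : T, m \in K /\ forall x : T, x \in K -> connect e x m).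

Definition C_confluent (P : {set {set 'S_3}}) (C : {set 'S_3}) : Prop :=
  forall n : nat, confluent (@straightening P C n).

(* Main.v *)
(** Two overlapping hits share letters that force both to be increasing-like
    (right leaning and right polarized) or both decreasing-like, so backward
    hits are disjoint from all others.  Rearranging a hit does not change the
    polarization of a disjoint hit, since a neighbour of the latter only moves
    among three consecutive values on one side of it.  Straightening therefore
    replaces a hit by a representative of its part determined by the
    polarization; representatives are chosen by the preference 123, 132, 213
    among right leaning and 321, 231, 312 among left leaning permutations.

    Straightening terminates: the number of backward hits does not increase,
    and a step that keeps the leaning of its hit decreases a weighted number of
    pairs x, x+1 standing in the wrong order.  It is locally confluent: two
    overlapping hits can both be unstraightened only if 123, 132, 213 (or their
    reversals) lie in one part, and then both straightenings sort.  Newman's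
    lemma yields (A), and identifies the equivalence classes with the words
    without unstraightened hits.

    Under the hypotheses of (B) unstraightened hits never overlap.  Any j
    disjoint positions carry unstraightened hits in k^j (n - 2j)! words: each
    hit can be traded for an increasing run in k ways, and contracting the
    runs leaves an arbitrary permutation of n - 2j letters.  Inclusion-exclusion
    over the C(n - 2j, j) sets of such positions gives the formula. *)

Require Import Defs.
From mathcomp Require Import all_boot all_order all_fingroup all_algebra.
From mathcomp Require Import zify ring.

Set Implicit Arguments.
Unset Strict Implicit.
Unset Printing Implicit Defensive.

(** * Patterns and hits in words *)

(* Each list is in the order of preference in which [nf] below selects the
   representative of a part. *)
Definition inc_pats := [:: [:: 1; 2; 3]; [:: 1; 3; 2]; [:: 2; 1; 3]].
Definition dec_pats := [:: [:: 3; 2; 1]; [:: 2; 3; 1]; [:: 3; 1; 2]].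
Definition pats (d : bool) :=
  if d then inc_pats ++ dec_pats else dec_pats ++ inc_pats.

(* When three letters form a hit, [pat] is the permutation they form and
   [base] the shift; otherwise both are junk. *)
Definition base (s : seq nat) (i : nat) : nat :=
  (minn (nth 0 s i) (minn (nth 0 s i.+1) (nth 0 s i.+2))).-1.

Definition pat (s : seq nat) (i : nat) : seq nat :=
  [seq x - base s i | x <- [:: nth 0 s i; nth 0 s i.+1; nth 0 s i.+2]].

Definition hit (s : seq nat) (i : nat) : bool :=
  (i.+2 < size s) && (pat s i \in pats true).

Definition repl (s : seq nat) (i : nat) (u : seq nat) : seq nat :=
  take i s ++ [seq base s i + x | x <- u] ++ drop (i + 3) s.

Lemma mem_pats d (u : seq nat) : (u \in pats d) = (u \in pats true).
Proof. by case: d; rewrite // !mem_cat orbC. Qed.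

Lemma pats_ind (Q : seq nat -> Prop) :
  Q [:: 1; 2; 3] -> Q [:: 1; 3; 2] -> Q [:: 2; 1; 3] ->
  Q [:: 3; 2; 1] -> Q [:: 2; 3; 1] -> Q [:: 3; 1; 2] ->
  forall u, u \in pats true -> Q u.
Proof. by move=> ? ? ? ? ? ? u; rewrite !inE; do 5?[case/orP]; move/eqP->. Qed.

Lemma size_pats (u : seq nat) : u \in pats true -> size u = 3.
Proof. by move: u; apply: pats_ind. Qed.

Lemma factor3E (s : seq nat) i : i.+2 < size s ->
  factor3 s i = [:: nth 0 s i; nth 0 s i.+1; nth 0 s i.+2].
Proof.
move=> lt_i; rewrite /factor3.
by do 3![rewrite (drop_nth 0) ?take_cons; last by lia]; rewrite take0.
Qed.

Lemma hit_nth (s : seq nat) i c : hit s i -> c < 3 ->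
  nth 0 s (i + c) = base s i + nth 0 (pat s i) c.
Proof.
case/andP=> _; rewrite /pat; set k := base s i => hp.
have hk : k <= nth 0 s i /\ k <= nth 0 s i.+1 /\ k <= nth 0 s i.+2.
  by rewrite /k /base; lia.
by case: c => [|[|[|c]]] // _; rewrite ?addn0 ?addn1 ?addn2 /=; lia.
Qed.

(** The six patterns are spelled out as equations on [x], [y], [z], grouped by leaning, so that case
    analyses on a hit reduce to linear arithmetic. *)
Variant hit_spec (s : seq nat) (i : nat) : bool -> seq nat -> nat -> Prop :=
| HitSpec d u k x y z of i.+2 < size s & base s i = k & pat s i = u
    & u = [:: x; y; z] & d = (u \in inc_pats)
    & nth 0 s i = k + x & nth 0 s i.+1 = k + y & nth 0 s i.+2 = k + z
    & [|| [&& x == 1, y == 2 & z == 3], [&& x == 1, y == 3 & z == 2]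
       | [&& x == 2, y == 1 & z == 3]] && d
      || [|| [&& x == 3, y == 2 & z == 1], [&& x == 2, y == 3 & z == 1]
       | [&& x == 3, y == 1 & z == 2]] && ~~ d :
    hit_spec s i d u k.

Lemma hitP (s : seq nat) i : hit s i ->
  hit_spec s i (pat s i \in inc_pats) (pat s i) (base s i).
Proof.
move=> hs; have /andP[lt_i hu] := hs.
have := hit_nth (c := 0) hs isT; have := hit_nth (c := 1) hs isT.
have := hit_nth (c := 2) hs isT; rewrite addn0 addn1 addn2.
move: (size_pats hu); case def_u: (pat s i) hu => [|x [|y [|z []]]] //= hu _ h2
  h1 h0.
apply: (HitSpec lt_i _ def_u _ _ h0 h1 h2) => //.
move: hu; rewrite !inE !eqseq_cons !eqxx !andbT /=.
by move=> /orP[/eqP|]; lia.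
Qed.

Lemma hit_intro (s : seq nat) i (u : seq nat) k : i.+2 < size s ->
  u \in pats true ->
  nth 0 s i = k + nth 0 u 0 -> nth 0 s i.+1 = k + nth 0 u 1 ->
  nth 0 s i.+2 = k + nth 0 u 2 -> [/\ hit s i, pat s i = u & base s i = k].
Proof.
move=> lt_i hu h0 h1 h2.
have bk : base s i = k.
  by rewrite /base h0 h1 h2; move: u hu {h0 h1 h2}; apply: pats_ind => /=; lia.
have pu : pat s i = u.
  rewrite /pat bk /= h0 h1 h2; move: u hu {h0 h1 h2}.
  by apply: pats_ind => /=; rewrite !addKn.
by rewrite /hit lt_i pu.
Qed.

Lemma hit_factor3 (s : seq nat) i (u : seq nat) k : u \in pats true ->
  factor3 s i = [seq x + k | x <- u] -> [/\ hit s i, pat s i = u & base s i =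
    k].
Proof.
move=> hu hf; have lt_i : i.+2 < size s.
  have := congr1 size hf.
  by rewrite size_map (size_pats hu) /factor3 size_take size_drop; case: ifP;
    lia.
move: hf; rewrite factor3E //; move: (size_pats hu) => su.
case: u hu su => [|x [|y [|z []]]] //= hu _ [h0 h1 h2].
by apply: hit_intro => //=; lia.
Qed.

Lemma factor3_hit (s : seq nat) i : hit s i -> factor3 s i =
  [seq base s i + x | x <- pat s i].
Proof.
move=> hs; case: (hitP hs) => d u k x y z lt_i _ _ -> _ h0 h1 h2 _.
by rewrite factor3E // h0 h1 h2.
Qed.

(** The letters of a hit exhaust the three values above its base, so in a word without repetition no
    other position can carry one of them. *)
Lemma block_pos (s : seq nat) i p : uniq s -> hit s i -> p < size s ->
  (base s i < nth 0 s p <= base s i + 3) = (i <= p < i + 3).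
Proof.
move=> us hs lt_p; case: (hitP hs) => d u k x y z lt_i _ _ _ _ h0 h1 h2 hxyz.
have e0 := nth_uniq 0 lt_p (ltnW (ltnW lt_i)) us.
have e1 := nth_uniq 0 lt_p (ltnW lt_i) us.
have e2 := nth_uniq 0 lt_p lt_i us.
rewrite h0 in e0; rewrite h1 in e1; rewrite h2 in e2.
clear h0 h1 h2; move: (nth 0 s p) e0 e1 e2 hxyz => q e0 e1 e2 hxyz;
  clear - e0 e1 e2 hxyz.
have {hxyz}: (x + y + z == 6) && (0 < x <= 3) && (0 < y <= 3) && (0 < z <= 3) &&
  (x != y) && (y != z) && (x != z) by lia.
by move=> hxyz; apply/idP/idP => h; lia.
Qed.

(** * Replacing the letters of a hit in place *)

Lemma size_repl (s : seq nat) i (u : seq nat) : i.+2 < size s -> size u = 3 ->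
  size (repl s i u) = size s.
Proof. by move=> lt_i su; rewrite !size_cat size_map size_takel ?size_drop; lia.
Qed.

Lemma nth_repl (s : seq nat) i (u : seq nat) p : i.+2 < size s -> size u = 3 ->
  nth 0 (repl s i u) p =
    if i <= p < i + 3 then base s i + nth 0 u (p - i) else nth 0 s p.
Proof.
move=> lt_i su; rewrite /repl nth_cat size_takel; last by lia.
case: ltnP => [lt_p|le_p]; first by rewrite nth_take.
rewrite nth_cat size_map su /=.
have -> : (p - i < 3) = (p < i + 3) by lia.
case: ifP => lt_p; first by rewrite (nth_map 0) // su; lia.
by rewrite nth_drop; congr nth; lia.
Qed.

Lemma repl_pat (s : seq nat) i : hit s i -> repl s i (pat s i) = s.
Proof.
move=> hs; rewrite /repl -factor3_hit // /factor3 addnC -drop_drop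
  !cat_take_drop //.
Qed.

Lemma perm_repl (s : seq nat) i (u : seq nat) : hit s i -> u \in pats true ->
  perm_eq (repl s i u) s.
Proof.
move=> hs hu; rewrite -[X in perm_eq _ X](repl_pat hs).
rewrite perm_cat2l perm_cat2r perm_map //.
have /andP[_ hp] := hs; move: {hs} (pat s i) hp u hu.
by apply: pats_ind; apply: pats_ind.
Qed.

Lemma hit_repl (s : seq nat) i (u : seq nat) : hit s i -> u \in pats true ->
  [/\ hit (repl s i u) i, pat (repl s i u) i = u & base (repl s i u) i =
    base s i].
Proof.
move=> hs hu; have /andP[lt_i _] := hs; have su := size_pats hu.
by apply: hit_intro; rewrite ?size_repl ?nth_repl //;
   (case: ifP; last by lia) => _; congr (_ + nth _ _ _); lia.
Qed.

Lemma repl_repl (s : seq nat) i (u v : seq nat) : hit s i -> u \in pats true ->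
  v \in pats true ->
  repl (repl s i u) i v = repl s i v.
Proof.
move=> hs hu hv; have [hs' _ bs] := hit_repl hs hu.
have /andP[lt_i _] := hs; have /andP[lt_i' _] := hs'.
have su := size_pats hu; have sv := size_pats hv.
apply: (@eq_from_nth _ 0); first by rewrite !size_repl.
by move=> p _; rewrite !nth_repl // bs; case: ifP => // ->.
Qed.

Lemma hit_congr (s t : seq nat) i : size s = size t ->
  (forall c, c < 3 -> nth 0 s (i + c) = nth 0 t (i + c)) ->
  [/\ hit s i = hit t i, pat s i = pat t i & base s i = base t i].
Proof.
move=> es E; have := E 0 isT; have := E 1 isT; have := E 2 isT.
rewrite addn0 addn1 addn2 => E2 E1 E0.
have bE : base s i = base t i by rewrite /base E0 E1 E2.
have pE : pat s i = pat t i by rewrite /pat bE E0 E1 E2.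
by rewrite /hit pE es.
Qed.

Lemma hit_repl_disjoint (s : seq nat) i j (u : seq nat) : hit s i ->
  u \in pats true ->
  (i + 3 <= j) || (j + 3 <= i) ->
  [/\ hit (repl s i u) j = hit s j, pat (repl s i u) j = pat s j
     & base (repl s i u) j = base s j].
Proof.
move=> hs hu dij; have /andP[lt_i _] := hs; have su := size_pats hu.
apply: hit_congr => [|c lt_c]; first by rewrite size_repl.
by rewrite nth_repl //; case: ifP => //; lia.
Qed.

Lemma replC (s : seq nat) i j (u v : seq nat) : hit s i -> hit s j ->
  u \in pats true -> v \in pats true ->
  (i + 3 <= j) || (j + 3 <= i) ->
  repl (repl s i u) j v = repl (repl s j v) i u.
Proof.
move=> hi hj hu hv dij.
have [hj' _ bj] := hit_repl_disjoint hi hu dij.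
have dji : (j + 3 <= i) || (i + 3 <= j) by rewrite orbC.
have [hi' _ bi] := hit_repl_disjoint hj hv dji.
have su := size_pats hu; have sv := size_pats hv.
have /andP[lt_i _] := hi; have /andP[lt_j _] := hj.
apply: (@eq_from_nth _ 0); first by rewrite !size_repl // size_repl.
move=> p _; rewrite !nth_repl // ?size_repl //; rewrite bi bj.
by do 2!case: ifP => //; lia.
Qed.

(** * Polarization *)

Lemma right_polarizedE (s : seq nat) i : hit s i ->
  right_polarized s i =
    let a := base s i + 2 in
    let dist x := (x - a) + (a - x) in
    let l := nth 0 s i.-1 in
    let r := nth 0 s (i + 3) in
    if (0 < i) && (~~ (i + 3 < size s) || (dist l <= dist r)) then l < a
    else (i + 3 < size s) && (a < r).
Proof.
move=> hs; rewrite /right_polarized.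
(* Every pattern sums to 6, so the letters sum to three times the base plus 6 and the division is
   exact. *)
have -> : sumn (factor3 s i) %/ 3 = base s i + 2.
  rewrite factor3_hit //; case: (hitP hs) => d u k x y z _ _ _ -> _ _ _ _ hxyz.
  by rewrite /=; lia.
have /andP[lt_i _] := hs.
set w' := take i s ++ _.
have -> : size w' = size s - 2.
  by rewrite size_cat /= size_takel ?size_drop; lia.
have -> : (i.+1 < size s - 2) = (i + 3 < size s) by lia.
have -> : nth 0 w' i.+1 = nth 0 s (i + 3).
  rewrite nth_cat size_takel; last by lia.
  by case: ifP => [|_]; [lia|rewrite subSnn /= nth_drop addn0].
have hl : 0 < i -> nth 0 w' i.-1 = nth 0 s i.-1.
  move=> i0; rewrite nth_cat size_takel; last by lia.
  by case: ifP => [_|]; [rewrite nth_take //|]; lia.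
case: (ltnP 0 i) => [i0|_] /=; last by case: (_ < _).
by rewrite hl //; case: ifP => // _; case: (_ < _).
Qed.

(** A neighbour of the hit at [j] can move only inside the value block of the hit at [i]. If the two
    neighbours of [j] lie on opposite sides of its average, either choice gives the same
    polarization. If they lie on the same side, comparing distances amounts to comparing letters,
    and the other neighbour is outside the block of [i]. *)
Lemma right_polarized_repl_disjoint (s : seq nat) i j (u : seq nat) : uniq s ->
  hit s i -> hit s j ->
  u \in pats true -> (i + 3 <= j) || (j + 3 <= i) ->
  right_polarized (repl s i u) j = right_polarized s j.
Proof.
move=> us hi hj hu dij.
have [hj' pj bj] := hit_repl_disjoint hi hu dij.
rewrite hj in hj'.
rewrite !right_polarizedE //= bj.
have /andP[lt_i _] := hi; have su := size_pats hu; have /andP[lt_j _] := hj.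
rewrite size_repl //.
have us' : uniq (repl s i u) by rewrite (perm_uniq (perm_repl hi hu)).
have [hi' _ bi] := hit_repl hi hu.
have bl p : p < size s -> (base s i < nth 0 s p <= base s i + 3) =
  (i <= p < i + 3) := @block_pos s i p us hi.
have bl' p : p < size s -> (base s i < nth 0 (repl s i u) p <= base s i + 3) =
  (i <= p < i + 3).
  by rewrite -bi => hp; apply: block_pos; rewrite ?size_repl.
have cl p : p < size s -> (base s j < nth 0 s p <= base s j + 3) =
  (j <= p < j + 3) := @block_pos s j p us hj.
have same p : ~~ (i <= p < i + 3) -> nth 0 (repl s i u) p = nth 0 s p.
  by move=> hp; rewrite nth_repl // (negPf hp).
(* If the two value blocks met, the least or the greatest letter of the hit at [i] would lie in the
   block of [j]. *)
have Ci : (base s i + 3 <= base s j) || (base s j + 3 <= base s i).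
  have lt_i1 := ltnW lt_i; have lt_i0 := ltnW lt_i1.
  have := cl i; have := cl i.+1; have := cl i.+2; rewrite lt_i lt_i1 lt_i0.
  case: (hitP hi) => d1 u1 k x y z _ _ _ _ _ -> -> -> hxyz h2 h1 h0.
  have {}h0 := h0 isT; have {}h1 := h1 isT; have {}h2 := h2 isT.
  have {}hxyz : [|| (x == 1) && (y == 3), (x == 1) && (z == 3), (y == 1) &&
    (x == 3),
     (y == 1) && (z == 3), (z == 1) && (x == 3) | (z == 1) && (y == 3)]
       by clear - hxyz; lia.
  have {}h0 : ~~ (base s j < k + x <= base s j + 3) by clear - h0 dij; lia.
  have {}h1 : ~~ (base s j < k + y <= base s j + 3) by clear - h1 dij; lia.
  have {}h2 : ~~ (base s j < k + z <= base s j + 3) by clear - h2 dij; lia.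
  by clear - h0 h1 h2 hxyz; lia.
have [far|[e|e]] : (i + 3 < j) || (j + 3 < i) \/ (i + 3 = j \/ j + 3 = i)
  by lia.
- by rewrite !same //; lia.
- rewrite (same (j + 3)); last by lia.
  have lt_l : j.-1 < size s by lia.
  have := bl _ lt_l; have := bl' _ lt_l; have -> : i <= j.-1 < i + 3 by lia.
  have -> : 0 < j by lia.
  have := bl (j + 3).
  move: (nth 0 s j.-1) (nth 0 (repl s i u) j.-1) (nth 0 s (j + 3)) => l l' r.
  case: ltnP => [lt_r|_] /= Br hl' hl; last by clear - Ci hl hl'; lia.
  have {}Br : ~~ (base s i < r <= base s i + 3) by rewrite Br //; lia.
  by clear - Ci Br hl hl'; case: ifP; case: ifP; lia.
rewrite (same j.-1); last by lia.
have lt_r : j + 3 < size s by lia.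
have := bl _ lt_r; have := bl' _ lt_r; have -> : i <= j + 3 < i + 3 by lia.
have := bl j.-1; rewrite lt_r.
move: (nth 0 s j.-1) (nth 0 (repl s i u) (j + 3)) (nth 0 s (j + 3)) => l r r'.
case: (posnP j) => [_|j0] /= Bl hr' hr; first by clear - Ci hr hr'; lia.
have {}Bl : ~~ (base s i < l <= base s i + 3) by rewrite Bl; lia.
by clear - Ci Bl hr hr'; case: ifP; case: ifP; lia.
Qed.

Lemma right_polarized_repl (s : seq nat) i (u : seq nat) : hit s i ->
  u \in pats true ->
  right_polarized (repl s i u) i = right_polarized s i.
Proof.
move=> hs hu; have [hs' _ bs] := hit_repl hs hu.
have /andP[lt_i _] := hs; have su := size_pats hu.
rewrite !right_polarizedE //= bs size_repl // !nth_repl // ltnn andbF /=.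
case: (posnP i) => [->|i0] //=.
by have -> : i <= i.-1 = false by lia.
Qed.

(** * Overlapping hits *)

Lemma hit_nths (s : seq nat) i : hit s i ->
  [/\ nth 0 s i = base s i + nth 0 (pat s i) 0,
      nth 0 s i.+1 = base s i + nth 0 (pat s i) 1
    & nth 0 s i.+2 = base s i + nth 0 (pat s i) 2].
Proof.
by move=> hs; rewrite -!hit_nth // addn0 addn1 addn2.
Qed.

Lemma block_out (s : seq nat) i p : uniq s -> hit s i -> p < size s ->
  ~~ (i <= p < i + 3) -> ~~ (base s i < nth 0 s p <= base s i + 3).
Proof. by move=> us hs lt_p; rewrite block_pos. Qed.

(** Letters outside a hit avoid its values, which leaves the shapes 1234 and 1324 and their
    reversals. The neighbour that each hit gets from the other is at distance 2 from its average,
    the least possible; a tie comes from the opposite side and yields the same polarization.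
    Booleans are added on both sides of the equation of bases to avoid truncated subtraction. *)
Lemma overlap1 (s : seq nat) i : uniq s -> hit s i -> hit s i.+1 ->
  let d := pat s i \in inc_pats in
  [/\ (pat s i, pat s i.+1) \in
        if d then [:: ([:: 1; 2; 3], [:: 1; 2; 3]); ([:: 1; 3; 2], [:: 2; 1;
          3])]
        else [:: ([:: 3; 2; 1], [:: 3; 2; 1]); ([:: 3; 1; 2], [:: 2; 3; 1])],
      base s i.+1 + ~~ d = base s i + d,
      right_polarized s i = d & right_polarized s i.+1 = d].
Proof.
move=> us hi hj; rewrite !right_polarizedE //.
have [lt_i hu] := andP hi; have [lt_j hv] := andP hj.
have l_i : 0 < i -> ~~ (base s i < nth 0 s i.-1 <= base s i + 3).
  by move=> i0; apply: block_out => //; lia.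
have l_j : 0 < i -> ~~ (base s i.+1 < nth 0 s i.-1 <= base s i.+1 + 3).
  by move=> i0; apply: block_out => //; lia.
have r_i : i + 4 < size s -> ~~ (base s i < nth 0 s (i + 4) <= base s i + 3).
  by move=> i0; apply: block_out => //; lia.
have r_j : i + 4 < size s -> ~~ (base s i.+1 < nth 0 s (i + 4) <= base s i.+1 +
  3).
  by move=> i0; apply: block_out => //; lia.
have q_i : ~~ (base s i < nth 0 s (i + 3) <= base s i + 3).
  by apply: block_out => //; lia.
have q_j : ~~ (base s i.+1 < nth 0 s i <= base s i.+1 + 3).
  by apply: block_out => //; lia.
have e3 : i.+3 = i + 3 by lia.
have e4 : i.+1 + 3 = i + 4 by lia.
have [h0 h1 h2] := hit_nths hi; have [] := hit_nths hj.
rewrite h1 h2 e3 e4 h0 in q_j * => h1' h2' h3'; rewrite h3' in q_i *.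
have -> : i + 3 < size s by lia.
clear h0 h1 h2 h3' hi hj us lt_i e3 e4.
move: (nth 0 s i.-1) (nth 0 s (i + 4)) (base s i) (base s i.+1) => l r k k' in
  l_i l_j r_i r_j h1' h2' q_i q_j *.
clear lt_j; move: (size s) r_i r_j => n r_i r_j.
move: (pat s i) hu (pat s i.+1) hv h1' h2' q_i q_j.
apply: pats_ind; apply: pats_ind => /= h1' h2' q_i q_j; try (exfalso;
  clear - h1' h2' q_i q_j; lia);
 clear q_i q_j h2'; rewrite ?in_cons ?in_nil ?eqxx ?orbT /=; split=> //=;
 try (clear - h1'; lia);
 case: (posnP i) l_i l_j => [i0|i0] l_i l_j;
   case: (i + 4 < n) r_i r_j => /= r_i r_j;
 try (case: ifP); clear - h1' l_i l_j r_i r_j; lia.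
Qed.

(** The shared letter is the largest of one hit and the smallest of the other, so the two hits fill
    five consecutive values. A neighbour outside both hits is therefore either farther away than the
    neighbour inside the other hit, or on the opposite side, where it gives the same
    polarization. *)
Lemma overlap2 (s : seq nat) i : uniq s -> hit s i -> hit s i.+2 ->
  let d := pat s i \in inc_pats in
  [/\ pat s i \in if d then [:: [:: 1; 2; 3]; [:: 2; 1; 3]]
                  else [:: [:: 3; 2; 1]; [:: 2; 3; 1]],
      pat s i.+2 \in if d then [:: [:: 1; 2; 3]; [:: 1; 3; 2]]
                     else [:: [:: 3; 2; 1]; [:: 3; 1; 2]],
      base s i.+2 + (~~ d).*2 = base s i + d.*2
    & right_polarized s i = d /\ right_polarized s i.+2 = d].
Proof.
move=> us hi hj; rewrite !right_polarizedE //.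
have [lt_i hu] := andP hi; have [lt_j hv] := andP hj.
have l_i : 0 < i -> ~~ (base s i < nth 0 s i.-1 <= base s i + 3).
  by move=> i0; apply: block_out => //; lia.
have l_j : 0 < i -> ~~ (base s i.+2 < nth 0 s i.-1 <= base s i.+2 + 3).
  by move=> i0; apply: block_out => //; lia.
have r_i : i + 5 < size s -> ~~ (base s i < nth 0 s (i + 5) <= base s i + 3).
  by move=> i0; apply: block_out => //; lia.
have r_j : i + 5 < size s -> ~~ (base s i.+2 < nth 0 s (i + 5) <= base s i.+2 +
  3).
  by move=> i0; apply: block_out => //; lia.
have q_i : ~~ (base s i < nth 0 s (i + 3) <= base s i + 3).
  by apply: block_out => //; lia.
have q_i' : ~~ (base s i < nth 0 s (i + 3).+1 <= base s i + 3).
  by apply: block_out => //; lia.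
have e3 : i.+3 = i + 3 by lia.
have e5 : i.+2 + 3 = i + 5 by lia.
have [h0 h1 h2] := hit_nths hi; have [] := hit_nths hj.
rewrite h2 e3 e5 -[i.+2.-1]/i.+1 h1 => h2' h3' h4'; rewrite h3' in q_i *;
  rewrite h4' in q_i'.
have -> : i + 3 < size s by lia.
clear h0 h1 h2 h3' h4' hi hj us lt_i e3 e5.
move: (nth 0 s i.-1) (nth 0 s (i + 5)) (base s i) (base s i.+2) => l r k k' in
  l_i l_j r_i r_j h2' q_i q_i' *.
clear lt_j; move: (size s) r_i r_j => n r_i r_j.
move: (pat s i) hu (pat s i.+2) hv h2' q_i q_i'.
apply: pats_ind; apply: pats_ind => /= h2' q_i q_i'; try (exfalso;
  clear - h2' q_i q_i'; lia);
 clear q_i q_i'; rewrite ?in_cons ?in_nil ?eqxx ?orbT /=; split=> //=;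
 try (clear - h2'; lia); split;
 case: (posnP i) l_i l_j => [i0|i0] l_i l_j;
   case: (i + 5 < n) r_i r_j => /= r_i r_j;
 try (case: ifP); clear - h2' l_i l_j r_i r_j; lia.
Qed.

(** * Straightening *)

Lemma mem_inc d (u : seq nat) : u \in pats true ->
  ((u \in inc_pats) == d) = (index u (pats d) < 3).
Proof. by move: u; apply: pats_ind; case: d. Qed.

(** [cl] sends a pattern to a label of its part; [part_of P] is substituted for it later. The first
    pattern of the part in the order [pats d] is taken, so leaning [d] has priority. *)
Definition nf (T : eqType) (cl : seq nat -> T) (d : bool) (u : seq nat) :=
  nth u (pats d) (find (fun v => cl v == cl u) (pats d)).

Definition nf_at (T : eqType) (cl : seq nat -> T) (s : seq nat) (i : nat) :=
  nf cl (right_polarized s i) (pat s i).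

Definition bad (T : eqType) (cl : seq nat -> T) (s : seq nat) (i : nat) :=
  hit s i && (pat s i != nf_at cl s i).

Definition straighten (T : eqType) (cl : seq nat -> T) (s : seq nat) (i :
  nat) :=
  repl s i (nf_at cl s i).

Lemma has_nf (T : eqType) (cl : seq nat -> T) d (u : seq nat) :
  u \in pats true -> has (fun v => cl v == cl u) (pats d).
Proof. by move=> hu; apply/hasP; exists u; rewrite ?mem_pats. Qed.

Lemma nf_mem (T : eqType) (cl : seq nat -> T) d (u : seq nat) :
  u \in pats true -> nf cl d u \in pats true.
Proof.
by move=> hu; rewrite -(mem_pats d) mem_nth // -has_find; apply: has_nf.
Qed.

Lemma nf_cl (T : eqType) (cl : seq nat -> T) d (u : seq nat) :
  u \in pats true -> cl (nf cl d u) = cl u.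
Proof. by move=> hu; apply/eqP; apply: (nth_find u (has_nf cl d hu)). Qed.

Lemma nf_eq (T : eqType) (cl : seq nat -> T) d (u v : seq nat) :
  u \in pats true -> cl u = cl v -> nf cl d u = nf cl d v.
Proof.
move=> hu e; rewrite /nf -e; apply: set_nth_default.
by rewrite -has_find; apply: has_nf.
Qed.

Lemma nf_index (T : eqType) (cl : seq nat -> T) d (u v : seq nat) :
  u \in pats true -> v \in pats true -> cl v = cl u ->
  index (nf cl d u) (pats d) <= index v (pats d).
Proof.
move=> hu hv e; rewrite /nf index_uniq -?has_find ?has_nf //; last by case: d.
rewrite leqNgt; apply/negP => /(before_find u).
by rewrite nth_index ?mem_pats // e eqxx.
Qed.

(** The three patterns of leaning [d] open the list [pats d], so a part containing one of them has
    its first pattern among them. *)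
Lemma nf_lean (T : eqType) (cl : seq nat -> T) d (u v : seq nat) :
  u \in pats true -> v \in pats true -> cl v = cl u -> (v \in inc_pats) = d ->
  (nf cl d u \in inc_pats) = d.
Proof.
move=> hu hv e /eqP; rewrite mem_inc // => lt_v.
by apply/eqP; rewrite mem_inc ?nf_mem //; apply: leq_ltn_trans lt_v;
  apply: nf_index.
Qed.

Lemma nf_lt (T : eqType) (cl : seq nat -> T) d (u : seq nat) :
  u \in pats true -> u != nf cl d u ->
  index (nf cl d u) (pats d) < index u (pats d).
Proof.
move=> hu ne; rewrite ltn_neqAle nf_index // andbT; apply: contra ne => /eqP e.
have hn := nf_mem cl d hu.
by rewrite -{1}(nth_index [::] (_ : u \in pats d)) ?mem_pats // -e nth_index
  ?mem_pats.
Qed.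

(** For [d = true] these are 123, 132, 213; for [d = false] they are 321, 231, 312. *)
Definition top d := nth [::] (pats d) 0.
Definition mid d := nth [::] (pats d) 1.
Definition low d := nth [::] (pats d) 2.

Lemma nf_top (T : eqType) (cl : seq nat -> T) d (u : seq nat) :
  u \in pats true -> cl (top d) = cl u -> nf cl d u = top d.
Proof.
move=> hu e.
have ht : top d \in pats true by case: d {e}.
have := nf_index d hu ht e; have := nf_mem cl d hu; rewrite -(mem_pats d) => hn.
have -> : index (top d) (pats d) = 0 by case: (d).
by rewrite leqn0 => /eqP h; rewrite -(nth_index [::] hn) h.
Qed.

Lemma nf_mid (T : eqType) (cl : seq nat -> T) d :
  mid d != nf cl d (mid d) -> cl (top d) = cl (mid d).
Proof.
move=> ne; have hu : mid d \in pats true by case: d {ne}.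
have := nf_lt hu ne; have := nf_mem cl d hu; rewrite -(mem_pats d) => hn.
have -> : index (mid d) (pats d) = 1 by case: (d).
rewrite ltnS leqn0 => /eqP h; rewrite -[RHS](nf_cl cl d) //.
by rewrite -(nth_index [::] hn) h.
Qed.

Lemma nf_low (T : eqType) (cl : seq nat -> T) d :
  low d != nf cl d (low d) -> cl (top d) = cl (low d) \/ cl (mid d) =
    cl (low d).
Proof.
move=> ne; have hu : low d \in pats true by case: d {ne}.
have := nf_lt hu ne; have := nf_mem cl d hu; rewrite -(mem_pats d) => hn.
have -> : index (low d) (pats d) = 2 by case: (d).
have := nth_index [::] hn.
by case: (index _ _) => [|[|]] // e _; [left|right];
  rewrite -(nf_cl cl d hu) -e.
Qed.

Lemma nf_merge (T : eqType) (cl : seq nat -> T) d :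
  mid d != nf cl d (mid d) -> low d != nf cl d (low d) ->
  cl (mid d) = cl (top d) /\ cl (low d) = cl (top d).
Proof. by move=> /nf_mid e /nf_low []; rewrite e. Qed.

(** A monotone pattern is its own normal form for the polarization forced by the overlap. Hence one
    hit has pattern [mid d] and the other [low d], and both being abnormal puts them in the part of
    [top d]. *)
Lemma bad_overlap (T : eqType) (cl : seq nat -> T) (s : seq nat) i j :
  uniq s -> bad cl s i -> bad cl s j -> i < j -> j < i + 3 ->
  exists d, [/\ cl (mid d) = cl (top d), cl (low d) = cl (top d),
    right_polarized s i = d /\ right_polarized s j = d &
    [/\ j = i.+1, pat s i = (if d then mid d else low d),
        pat s j = (if d then low d else mid d) &
        base s j + ~~ d = base s i + d] \/
    [/\ j = i.+2, pat s i = (if d then low d else mid d),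
        pat s j = (if d then mid d else low d) &
        base s j + (~~ d).*2 = base s i + d.*2]].
Proof.
move=> us /andP[hi bi] /andP[hj bj] lt_ij lt_j.
have nt d : top d != nf cl d (top d) -> False.
  by rewrite nf_top ?eqxx //; case: d.
exists (pat s i \in inc_pats).
have [ej|ej] : j = i.+1 \/ j = i.+2 by lia.
  subst j; have [] := overlap1 us hi hj; set d := _ \in inc_pats.
  move=> hp hb pi pj; move: bi bj; rewrite /nf_at pi pj => bi bj.
  have [ei ej] : pat s i = (if d then mid d else low d) /\
             pat s i.+1 = (if d then low d else mid d).
    move: hp; case: (d) bi bj => bi bj; rewrite !inE !xpair_eqE.
      by case/orP=> /andP[/eqP e1 /eqP e2] //; case: (nt true); move: bi;
        rewrite e1.
    by case/orP=> /andP[/eqP e1 /eqP e2] //; case: (nt false); move: bi;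
      rewrite e1.
  have [e1 e2] : cl (mid d) = cl (top d) /\ cl (low d) = cl (top d).
    by apply: nf_merge; move: bi bj; rewrite ei ej; case: (d).
  by split=> //; left.
subst j; have [] := overlap2 us hi hj; set d := _ \in inc_pats.
move=> hpi hpj hb [pi pj]; move: bi bj; rewrite /nf_at pi pj => bi bj.
have ei : pat s i = (if d then low d else mid d).
  move: hpi; case: (d) bi => bi; rewrite !inE.
    by case/orP => /eqP e1 //; case: (nt true); move: bi; rewrite e1.
  by case/orP => /eqP e1 //; case: (nt false); move: bi; rewrite e1.
have ej : pat s i.+2 = (if d then mid d else low d).
  move: hpj; case: (d) bj => bj; rewrite !inE.
    by case/orP => /eqP e1 //; case: (nt true); move: bj; rewrite e1.
  by case/orP => /eqP e1 //; case: (nt false); move: bj; rewrite e1.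
have [e1 e2] : cl (mid d) = cl (top d) /\ cl (low d) = cl (top d).
  by apply: nf_merge; move: bi bj; rewrite ei ej; case: (d).
by split=> //; right.
Qed.

Lemma straighten_confluent (T : eqType) (cl : seq nat -> T) (s : seq nat) i j :
  uniq s -> bad cl s i -> bad cl s j -> i < j ->
  straighten cl s i = straighten cl s j \/
  [/\ bad cl (straighten cl s i) j, bad cl (straighten cl s j) i &
      straighten cl (straighten cl s i) j = straighten cl (straighten cl s j)
        i].
Proof.
move=> us bi bj lt_ij; have [hi _] := andP bi; have [hj _] := andP bj.
have ni : nf_at cl s i \in pats true by have [_ ?] := andP hi; apply: nf_mem.
have nj : nf_at cl s j \in pats true by have [_ ?] := andP hj; apply: nf_mem.
have [le_j|lt_j] := leqP (i + 3) j.
  have dij : (i + 3 <= j) || (j + 3 <= i) by rewrite le_j.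
  have dji : (j + 3 <= i) || (i + 3 <= j) by rewrite orbC.
  have [hj' pj' _] := hit_repl_disjoint hi ni dij.
  have [hi' pi' _] := hit_repl_disjoint hj nj dji.
  have rj' := right_polarized_repl_disjoint us hi hj ni dij.
  have ri' := right_polarized_repl_disjoint us hj hi nj dji.
  have ej : nf_at cl (straighten cl s i) j = nf_at cl s j
    by rewrite /nf_at pj' rj'.
  have ei : nf_at cl (straighten cl s j) i = nf_at cl s i
    by rewrite /nf_at pi' ri'.
  right; split; rewrite /bad ?ei ?ej ?hi' ?hj' ?pi' ?pj' //.
  by rewrite /straighten ei ej; apply: replC.
have [d [em el [pi pj] sh]] := bad_overlap us bi bj lt_ij lt_j.
have mm : mid d \in pats true by case: (d).
have ml : low d \in pats true by case: (d).
have ti : nf_at cl s i = top d.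
  rewrite /nf_at pi; case: sh => [] [_ -> _ _]; rewrite nf_top //;
    by case: (d) em el.
have tj : nf_at cl s j = top d.
  rewrite /nf_at pj; case: sh => [] [_ _ -> _]; rewrite nf_top //;
    by case: (d) em el.
have st : size (top d) = 3 by case: (d).
have [lt_i _] := andP hi; have [lt_j' _] := andP hj.
have [n0 n1 n2] := hit_nths hi; have [m0 m1 m2] := hit_nths hj.
rewrite /straighten ti tj.
(* With two shared letters the shape is 1324 or 4231, and either straightening exchanges the two
   middle letters. *)
case: sh => [] [ej ei' ej' eb]; subst j.
  left; apply: (@eq_from_nth _ 0) => [|p _]; rewrite ?size_repl // !nth_repl //.
  rewrite ei' in n0 n1 n2; rewrite ej' in m0 m1 m2.
  have [e|[e|[e|[e|e]]]] : p = i \/ (p = i.+1 \/ (p = i.+2 \/ (p = i.+3 \/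
      (p < i \/ i.+3 < p)))) by clear; lia.
  - subst p; have -> : i <= i < i + 3 by clear; lia.
    have -> : i.+1 <= i < i.+1 + 3 = false by clear; lia.
    by rewrite subnn n0; case: (d).
  - subst p; have -> : i <= i.+1 < i + 3 by clear; lia.
    have -> : i.+1 <= i.+1 < i.+1 + 3 by clear; lia.
    by rewrite subnn subSnn; clear - eb; case: (d) eb => /=; lia.
  - subst p; have -> : i <= i.+2 < i + 3 by clear; lia.
    have -> : i.+1 <= i.+2 < i.+1 + 3 by clear; lia.
    have -> : i.+2 - i = 2 by clear; lia. have -> : i.+2 - i.+1 = 1 by clear;
      lia.
    by clear - eb; case: (d) eb => /=; lia.
  - subst p; have -> : i <= i.+3 < i + 3 = false by clear; lia.
    have -> : i.+1 <= i.+3 < i.+1 + 3 by clear; lia.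
    have -> : i.+3 - i.+1 = 2 by clear; lia.
    by rewrite m2; case: (d).
  have -> : i <= p < i + 3 = false by clear - e; lia.
  by have -> : i.+1 <= p < i.+1 + 3 = false by clear - e; lia.
(* With one shared letter the shape is 21354 or 45312. The shared letter is already in place, so the
   two straightenings affect different letters and commute. *)
right.
have s1 : size (repl s i (top d)) = size s by rewrite size_repl.
have s2 : size (repl s i.+2 (top d)) = size s by rewrite size_repl.
have nth1 p : i.+2 <= p -> nth 0 (repl s i (top d)) p = nth 0 s p.
  move=> le_p; rewrite nth_repl //; case: ifP => // hp.
  have -> : p = i.+2 by clear - le_p hp; lia.
  have -> : i.+2 - i = 2 by clear; lia.
  by rewrite n2 ei'; case: (d).
have nth2 p : p <= i.+2 -> nth 0 (repl s i.+2 (top d)) p = nth 0 s p.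
  move=> le_p; rewrite nth_repl //; case: ifP => // hp.
  have -> : p = i.+2 by clear - le_p hp; lia.
  by rewrite m0 ej' subnn; case: (d).
have [hj1 pj1 bj1] := hit_congr (i := i.+2) s1 (fun c _ => nth1 _ (leq_addr c
  _)).
have [|hi2 pi2 bi2] := hit_congr (i := i) s2.
  by move=> c lt_c; apply: nth2; clear - lt_c; lia.
have htop : top d \in pats true by case: (d).
have u1 : uniq (repl s i (top d)) by rewrite (perm_uniq (perm_repl hi htop)).
have u2 : uniq (repl s i.+2 (top d)) by rewrite (perm_uniq (perm_repl hj htop)).
have [hi1 pi1 bi1] := hit_repl hi htop.
have [hj2 pj2 bj2] := hit_repl hj htop.
have rj1 : right_polarized (repl s i (top d)) i.+2 = d.
  have [_ _ _ [_ ->]] := overlap2 u1 hi1 (etrans hj1 hj).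
  by rewrite pi1; case: (d).
have ri2 : right_polarized (repl s i.+2 (top d)) i = d.
  have [_ _ _ [-> _]] := overlap2 u2 (etrans hi2 hi) hj2.
  by rewrite pi2 ei'; case: (d).
have tj1 : nf_at cl (repl s i (top d)) i.+2 = top d.
  by move: tj; rewrite /nf_at rj1 pj1 pj.
have ti2 : nf_at cl (repl s i.+2 (top d)) i = top d.
  by move: ti; rewrite /nf_at ri2 pi2 pi.
split.
- by rewrite /bad hj1 hj pj1 tj1 -tj; case/andP: bj.
- by rewrite /bad hi2 hi pi2 ti2 -ti; case/andP: bi.
rewrite tj1 ti2; apply: (@eq_from_nth _ 0) => [|p _].
  by rewrite !size_repl ?s1 ?s2.
rewrite (nth_repl (s := repl s i _)) ?s1 // (nth_repl (s := repl s i.+2 _)) ?s2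
  //.
rewrite bj1 bi2 !nth_repl //.
case: ifP; case: ifP => // h1 h2.
have -> : p = i.+2 by clear - h1 h2; lia.
have -> : i.+2 - i = 2 by clear; lia.
by rewrite subnn; clear - eb; case: (d) eb => /=; lia.
Qed.

(** * Termination *)

Definition backward_hit (s : seq nat) (i : nat) :=
  hit s i && ((pat s i \in inc_pats) != right_polarized s i).

(* The index of a missing letter is [size s]: the letters 0 and n + 1 behave as
   if they stood to the right of the word. *)
Definition before (s : seq nat) (x y : nat) := index x s < index y s.

(* The letters v+1 and v+2 can only belong to hits of one leaning, given the
   order of the pairs at distance at least 2 among v, ..., v+3.  Rearrangements
   preserving the leaning do not affect the order of these pairs. *)
Definition direction (s : seq nat) (v : nat) :=
  if before s v v.+2 == before s v.+1 v.+3 then before s v v.+2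
  else ~~ before s v v.+3.

Definition crossing (s : seq nat) (v : nat) :=
  before s v.+1 v.+2 != direction s v.

(** The coefficients strictly decrease in [v]: repairing the lower of two neighbouring pairs
    outweighs a new crossing at the upper one. *)
Definition weight (n : nat) (s : seq nat) := \sum_(v < n) (n - v) * crossing s
  v.

(** Weights are at most [n * n], so this orders words lexicographically, by the number of backward
    hits first. *)
Definition potential (n : nat) (s : seq nat) :=
  #|[set i : 'I_n | backward_hit s i]| * (n * n).+1 + weight n s.

Lemma index_block (s : seq nat) i c : uniq s -> hit s i -> 0 < c <= 3 ->
  index (base s i + c) s = i + index c (pat s i) /\ index c (pat s i) < 3.
Proof.
move=> us hs hc; have /andP[lt_i hp] := hs.
have hc' : c \in pat s i.
  by move: (pat s i) hp; apply: pats_ind; rewrite !inE; clear - hc; lia.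
have lt_c : index c (pat s i) < 3 by have := hc';
  rewrite -index_mem (size_pats hp).
split=> //; rewrite -{1}(nth_index 0 hc') -hit_nth // index_uniq //.
by apply: leq_trans lt_i; rewrite -(addn3 i) ltn_add2l.
Qed.

Lemma index_out (s : seq nat) i x : uniq s -> hit s i ->
  ~~ (base s i < x <= base s i + 3) -> ~~ (i <= index x s < i + 3).
Proof.
move=> us hs hx; have [lt_i _] := andP hs.
case: (boolP (x \in s)) => [xs|]; last first.
  by move=> /memNindex ->; rewrite [X in _ && X]ltnNge addn3 lt_i andbF.
by rewrite -(block_pos us hs) ?index_mem ?nth_index.
Qed.

Lemma index_repl_out (s : seq nat) i (u : seq nat) x : uniq s -> hit s i ->
  u \in pats true -> ~~ (base s i < x <= base s i + 3) ->
  index x (repl s i u) = index x s.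
Proof.
move=> us hs hu hx; have pr := perm_repl hs hu.
have [lt_i _] := andP hs; have su := size_pats hu.
have us' : uniq (repl s i u) by rewrite (perm_uniq pr).
case: (boolP (x \in s)) => xs; last first.
  by rewrite !memNindex ?(perm_mem pr) ?size_repl.
have := index_out us hs hx; rewrite -index_mem in xs => ho.
have e : nth 0 (repl s i u) (index x s) = x.
  by rewrite nth_repl // (negPf ho) nth_index // -index_mem.
by rewrite -{1}e index_uniq // size_repl.
Qed.

Lemma index_block_in (s : seq nat) i x : uniq s -> hit s i ->
  base s i < x <= base s i + 3 -> i <= index x s < i + 3.
Proof.
move=> us hs hx.
have hc : 0 < x - base s i <= 3 by clear - hx; lia.
have [] := index_block us hs hc; rewrite subnKC; last by clear - hx; lia.
by move=> -> h; clear - h; lia.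
Qed.

Lemma before_repl (s : seq nat) i (u : seq nat) x y : uniq s -> hit s i ->
  u \in pats true ->
  ~~ ((base s i < x <= base s i + 3) && (base s i < y <= base s i + 3)) ->
  before (repl s i u) x y = before s x y.
Proof.
move=> us hs hu; have [hs' _ bs] := hit_repl hs hu.
have us' : uniq (repl s i u) by rewrite (perm_uniq (perm_repl hs hu)).
have I x' := @index_block_in s i x' us hs; have O x' := @index_out s i x' us hs.
have I' x' := @index_block_in (repl s i u) i x' us' hs'; rewrite /before.
case: (boolP (base s i < x <= _)) => hx;
  case: (boolP (base s i < y <= _)) => hy // _.
- have := I _ hx; have := O _ hy; rewrite (index_repl_out us hs hu hy).
  by rewrite -bs in hx; have := I' _ hx; clear; lia.
- have := I _ hy; have := O _ hx; rewrite (index_repl_out us hs hu hx).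
  by rewrite -bs in hy; have := I' _ hy; clear; lia.
by rewrite !index_repl_out.
Qed.

Lemma before_block (s : seq nat) i b c : uniq s -> hit s i -> 0 < b <= 3 ->
  0 < c <= 3 ->
  before s (base s i + b) (base s i + c) = (index b (pat s i) < index c (pat s
    i)).
Proof.
move=> us hs hb hc; rewrite /before.
by have [-> _] := index_block us hs hb; have [-> _] := index_block us hs hc;
  rewrite ltn_add2l.
Qed.

Lemma lean_index (u : seq nat) : u \in pats true ->
  (index 1 u < index 3 u) = (u \in inc_pats).
Proof. by move: u; apply: pats_ind. Qed.

(** The letter just below or just above the block stands on one side of the whole hit, so its two
    comparisons with letters of the hit agree. If they also agree with the leaning, [direction]
    returns them; otherwise it returns their negation, which is again the leaning. *)
Lemma direction_block (s : seq nat) i : uniq s -> hit s i ->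
  direction s (base s i) = (pat s i \in inc_pats) /\
  direction s (base s i).+1 = (pat s i \in inc_pats).
Proof.
move=> us hs; have [lt_i hp] := andP hs.
have := before_block us hs (isT : 0 < 1 <= 3) (isT : 0 < 3 <= 3).
rewrite (lean_index hp) addn1 addn3 /direction /before.
have := index_block_in (x := (base s i).+1) us hs;
  have := index_block_in (x := (base s i).+2) us hs.
have := index_block_in (x := (base s i).+3) us hs.
have := index_out (x := base s i) us hs;
  have := index_out (x := (base s i).+4) us hs.
move: (base s i) => k; move: (pat s i \in inc_pats) => d.
move: (index k s) (index k.+1 s) (index k.+2 s) (index k.+3 s) (index k.+4 s).
clear => p p1 p2 p3 p4 h4 h h3 h2 h1 hd.
have {}h4 := h4 ltac:(clear; lia); have {}h3 := h3 ltac:(clear; lia).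
have {}h2 := h2 ltac:(clear; lia); have {}h1 := h1 ltac:(clear; lia).
have {}h := h ltac:(clear; lia).
by rewrite hd; split; case: ifP => /eqP; clear - h h1 h2 h3 h4 hd; lia.
Qed.

(** Among pairs at distance at least 2 in value, only [base + 1] and [base + 3] both lie in the hit,
    and their order is the leaning. *)
Lemma direction_repl (s : seq nat) i (u : seq nat) v : uniq s -> hit s i ->
  u \in pats true -> (u \in inc_pats) = (pat s i \in inc_pats) ->
  direction (repl s i u) v = direction s v.
Proof.
move=> us hs hu e; have [hs' ps bs] := hit_repl hs hu; have [_ hp] := andP hs.
have us' : uniq (repl s i u) by rewrite (perm_uniq (perm_repl hs hu)).
have H w : before (repl s i u) w w.+2 = before s w w.+2.
  have [->|ne] := eqVneq w (base s i + 1).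
    have e' : (base s i + 1).+2 = base s i + 3 by clear; lia.
    rewrite e' before_block // -bs before_block //.
    by rewrite ps !lean_index.
  by apply: before_repl => //; clear - ne; lia.
by rewrite /direction !H before_repl //; clear; lia.
Qed.

Lemma crossing_block (s : seq nat) i : uniq s -> hit s i ->
  let u := pat s i in let d := u \in inc_pats in
  crossing s (base s i) = ((index 1 u < index 2 u) != d) /\
  crossing s (base s i).+1 = ((index 2 u < index 3 u) != d).
Proof.
move=> us hs /=; rewrite /crossing.
have [-> ->] := direction_block us hs; rewrite -(before_block us hs) //.
by rewrite -(before_block us hs) // addn1 addn2 addn3.
Qed.

Lemma crossing_repl (s : seq nat) i (u : seq nat) v : uniq s -> hit s i ->
  u \in pats true -> (u \in inc_pats) = (pat s i \in inc_pats) ->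
  v != base s i -> v != (base s i).+1 ->
  crossing (repl s i u) v = crossing s v.
Proof.
move=> us hs hu e n0 n1; rewrite /crossing direction_repl // before_repl //.
by clear - n0 n1; lia.
Qed.

(** Within a leaning, the preference order is the lexicographic order of the two crossings: (0,0),
    (0,1), (1,0). *)
Lemma pats_crossing d (u v : seq nat) : u \in pats true -> v \in pats true ->
  (u \in inc_pats) = (v \in inc_pats) -> index u (pats d) < index v (pats d) ->
  let c0 u := (index 1 u < index 2 u) != (u \in inc_pats) in
  let c1 u := (index 2 u < index 3 u) != (u \in inc_pats) in
  (c0 u < c0 v) || (c0 u == c0 v) && (c1 u < c1 v).
Proof. by case: d; move: u; apply: pats_ind; move: v; apply: pats_ind. Qed.

Lemma base_le (n : nat) (s : seq nat) i : perm_eq s (iota 1 n) -> hit s i ->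
  base s i + 3 <= n.
Proof.
move=> ps hs; have us : uniq s by rewrite (perm_uniq ps) iota_uniq.
have [e lt3] := index_block us hs (isT : 0 < 3 <= 3).
have : base s i + 3 \in s.
  by rewrite -index_mem e; have [lt_i _] := andP hs; apply: leq_trans lt_i;
    rewrite -(addn3 i) ltn_add2l.
by rewrite (perm_mem ps) mem_iota; clear; lia.
Qed.

Lemma weight_repl (n : nat) (s : seq nat) i (u : seq nat) d :
  perm_eq s (iota 1 n) -> hit s i -> u \in pats true ->
  (u \in inc_pats) = (pat s i \in inc_pats) ->
  index u (pats d) < index (pat s i) (pats d) ->
  weight n (repl s i u) < weight n s.
Proof.
move=> ps hs hu e lt_u; have us : uniq s by rewrite (perm_uniq ps) iota_uniq.
have [hs' pu bs] := hit_repl hs hu; have [_ hp] := andP hs.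
have us' : uniq (repl s i u) by rewrite (perm_uniq (perm_repl hs hu)).
have le_k := base_le ps hs.
have lt_k : base s i < n by clear - le_k; lia.
have lt_k1 : (base s i).+1 < n by clear - le_k; lia.
have E t : weight n t = (n - base s i) * crossing t (base s i) +
    ((n - (base s i).+1) * crossing t (base s i).+1 +
     \sum_(v < n | (v != Ordinal lt_k) &&
       (v != Ordinal lt_k1)) (n - v) * crossing t v).
  by rewrite /weight (bigD1 (Ordinal lt_k)) // (bigD1 (Ordinal lt_k1)) //=
    -val_eqE /= gtn_eqF.
rewrite !E {E}.
rewrite (eq_bigr (fun v : 'I_n => (n - v) * crossing s v)); last first.
  by move=> v /andP[n0 n1]; rewrite crossing_repl.
have [-> ->] := crossing_block us hs.
have [] := crossing_block us' hs'; rewrite bs pu => -> ->.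
rewrite !addnA ltn_add2r; have := pats_crossing hu hp e lt_u.
by move: (pat s i) => v /=; do 4!case: (_ != _ :> bool) => //=; clear - le_k;
  lia.
Qed.

Lemma weight_le (n : nat) (s : seq nat) : weight n s <= n * n.
Proof.
rewrite -{2}[n]card_ord -sum_nat_const; apply: leq_sum => v _.
by case: (crossing _ _); rewrite ?muln1 ?muln0 ?leq_subr.
Qed.

Lemma backward_overlap (s : seq nat) i j : uniq s -> hit s i ->
  (i < j < i + 3) || (j < i < j + 3) -> ~~ backward_hit s j.
Proof.
move=> us hi hij; apply/negP => /andP[hj].
have [e|[e|[e|e]]] : j = i.+1 \/ (j = i.+2 \/ (i = j.+1 \/ i = j.+2))
  by clear - hij; lia.
- subst j; have [H _ _ ->] := overlap1 us hi hj; apply/negP; rewrite negbK.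
  by move: H; case: (_ \in inc_pats); rewrite !inE !xpair_eqE
    => /orP[]/andP[_ /eqP->].
- subst j; have [_ H _ [_ ->]] := overlap2 us hi hj; apply/negP; rewrite negbK.
  by move: H; case: (_ \in inc_pats); rewrite !inE => /orP[]/eqP->.
- by subst i; have [_ _ -> _] := overlap1 us hj hi; rewrite eqxx.
by subst i; have [_ _ _ [-> _]] := overlap2 us hj hi; rewrite eqxx.
Qed.

Lemma potential_straighten (T : eqType) (cl : seq nat -> T) n (s : seq nat) i :
  perm_eq s (iota 1 n) -> bad cl s i ->
  potential n (straighten cl s i) < potential n s.
Proof.
move=> ps bi; have [hi ne] := andP bi; have [lt_i hp] := andP hi.
have us : uniq s by rewrite (perm_uniq ps) iota_uniq.
have ss : size s = n by rewrite (perm_size ps) size_iota.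
have hn : nf_at cl s i \in pats true by apply: nf_mem.
rewrite /potential /straighten; set u := nf_at cl s i in hn ne *.
have [hi' pi' bi'] := hit_repl hi hn.
have us' : uniq (repl s i u) by rewrite (perm_uniq (perm_repl hi hn)).
have ri' := right_polarized_repl hi hn.
have lean_u : (pat s i \in inc_pats) = right_polarized s i ->
    (u \in inc_pats) = right_polarized s i.
  by move=> h; apply: (nf_lean hp hp).
(* No backward hit is created: disjoint hits keep their pattern and polarization, hits overlapping
   the one at [i] are never backward, and the hit at [i] stays forward if it was so. *)
have sub : {subset [set j : 'I_n | backward_hit (repl s i u) j]
                <= [set j : 'I_n | backward_hit s j]}.
  move=> j; rewrite !inE => bj; have [hj' rj'] := andP bj.
  have [dij|] := boolP ((i + 3 <= j) || (j + 3 <= i)).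
    have [hj pj _] := hit_repl_disjoint hi hn dij; rewrite hj' in hj.
    by rewrite /backward_hit -hj -pj -(right_polarized_repl_disjoint us hi (esym
      hj) hn dij).
  move=> dij; have [e|nij] := eqVneq (j : nat) i.
    move: rj'; rewrite /backward_hit e hi pi' ri' /= => rj'.
    by apply: contra rj' => /eqP /lean_u ->.
  have hij : (i < j < i + 3) || (j < i < j + 3) by clear - dij nij; lia.
  by move: bj; rewrite (negPf (backward_overlap us' hi' hij)).
have [el|nl] := eqVneq (u \in inc_pats) (pat s i \in inc_pats).
  have lt_u := nf_lt hp ne.
  have := weight_repl ps hi hn el lt_u.
  have := subset_leq_card (introT subsetP sub).
  by clear; nia.
(* The leaning changes only if it disagreed with the polarization, so the hit at [i] turns from
   backward to forward. *)
have lt_c : #|[set j : 'I_n | backward_hit (repl s i u) j]|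
          < #|[set j : 'I_n | backward_hit s j]|.
  have lt_in : i < n by rewrite -ss; exact: ltnW (ltnW lt_i).
  apply: proper_card; apply/properP; split; first exact/subsetP.
  exists (Ordinal lt_in); rewrite !inE /backward_hit /= ?hi ?hi' /=.
    by apply: contraNneq nl => h; rewrite lean_u ?h.
  rewrite pi' ri' negbK; move: nl lean_u; clear.
  by case: (u \in _); case: (pat s i \in _);
    case: (right_polarized s i) => //= _ /(_ erefl).
have := weight_le n (repl s i u); clear - lt_c; nia.
Qed.

(** * Newman's lemma *)

Definition terminal (T : finType) (e : rel T) (x : T) := [forall y, ~~ e x y].

Definition terminating (T : finType) (e : rel T) (mu : T -> nat) :=
  forall x y, e x y -> mu y < mu x.

Definition locally_confluent (T : finType) (e : rel T) :=
  forall x y z, e x y -> e x z -> exists2 t, connect e y t & connect e z t.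

Definition nform (T : finType) (e : rel T) (x : T) :=
  odflt x [pick m | connect e x m && terminal e m].

Lemma connect_step (T : finType) (e : rel T) (x y : T) :
  connect e x y -> x = y \/ exists2 z, e x z & connect e z y.
Proof.
case/connectP=> [[|z p] /=]; first by left.
by case/andP=> xz zp ->; right; exists z => //; apply/connectP; exists p.
Qed.

Lemma newman (T : finType) (e : rel T) (mu : T -> nat) :
  terminating e mu -> locally_confluent e ->
  forall x y z, connect e x y -> connect e x z ->
  exists2 t, connect e y t & connect e z t.
Proof.
move=> term lc x; have [n] := ubnP (mu x);
  elim: n x => // n IHn x lt_x y z xy xz.
have [<-|[y1 xy1 y1y]] := connect_step xy; first by exists z.
have [<-|[z1 xz1 z1z]] := connect_step xz; first by exists y.
have [t1 y1t1 z1t1] := lc _ _ _ xy1 xz1.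
have [|t2 yt2 t1t2] := IHn y1 _ y t1 y1y y1t1.
  exact: leq_trans (term _ _ xy1) lt_x.
have [|t3 t2t3 zt3] := IHn z1 _ t2 z (connect_trans z1t1 t1t2) z1z.
  exact: leq_trans (term _ _ xz1) lt_x.
by exists t3 => //; apply: connect_trans t2t3.
Qed.

Lemma connect_mu (T : finType) (e : rel T) (mu : T -> nat) :
  terminating e mu -> forall x y, connect e x y -> (x == y) || (mu y < mu x).
Proof.
move=> term x y /connectP[p]; elim: p x => [|z p IHp] x /=;
  first by move=> _ ->; rewrite eqxx.
case/andP=> xz zp def_y; rewrite orbC.
have lt_zx := term _ _ xz.
by case/orP: (IHp z zp def_y) => [/eqP <-|lt_yz];
  rewrite ?lt_zx ?(ltn_trans lt_yz lt_zx).
Qed.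

Lemma nformP (T : finType) (e : rel T) (mu : T -> nat) :
  terminating e mu -> forall x, connect e x (nform e x) &&
    terminal e (nform e x).
Proof.
move=> term x; rewrite /nform; case: pickP => //= no.
suff [m hm] : exists m, connect e x m && terminal e m by rewrite no in hm.
move: {no} x => x; have [n] := ubnP (mu x); elim: n x => // n IHn x lt_x.
have [nx|] := boolP (terminal e x); first by exists x; rewrite connect0.
rewrite negb_forall => /existsP[y]; rewrite negbK => xy.
have [m /andP[ym nm]] := IHn y (leq_trans (term _ _ xy) lt_x).
by exists m; rewrite (connect_trans (connect1 xy) ym).
Qed.

Lemma terminal_connect (T : finType) (e : rel T) (x y : T) :
  terminal e x -> connect e x y -> y = x.
Proof.
by move=> /forallP nx /connect_step[//|[z xz _]]; have := nx z; rewrite xz.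
Qed.

Lemma nform_connect (T : finType) (e : rel T) (mu : T -> nat) :
  terminating e mu -> locally_confluent e ->
  forall x y, connect e x y -> nform e x = nform e y.
Proof.
move=> term lc x y xy.
have /andP[xm nm] := nformP term x; have /andP[yn nn] := nformP term y.
have [t mt nt] := newman term lc xm (connect_trans xy yn).
by rewrite -(terminal_connect nm mt) (terminal_connect nn nt).
Qed.

Lemma nform_terminal (T : finType) (e : rel T) (mu : T -> nat) :
  terminating e mu -> forall x, terminal e x -> nform e x = x.
Proof.
by move=> term x nx; have /andP[/(terminal_connect nx)] := nformP term x.
Qed.

Lemma nform_sym (T : finType) (e : rel T) (mu : T -> nat) :
  terminating e mu -> locally_confluent e ->
  forall x y, connect [rel x y | e x y || e y x] x y = (nform e x == nform e y).
Proof.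
move=> term lc x y; set e' : rel T := [rel x y | _]; apply/idP/eqP.
  case/connectP=> p; elim: p x => [|z p IHp] x /=; first by move=> _ ->.
  case/andP=> xz zp /(IHp z zp) <-.
  by case/orP: xz => /connect1/(nform_connect term lc).
have sub : subrel (connect e) (connect e').
  by apply: connect_sub => a b ab; apply: connect1; rewrite /e' /= ab.
have sym : connect_sym e' by apply: sym_connect_sym => a b; rewrite /e' /= orbC.
move=> exy; have /andP[xm _] := nformP term x;
  have /andP[yn _] := nformP term y.
by apply: connect_trans (sub _ _ xm) _; rewrite exy sym; apply: sub.
Qed.

Lemma newman_confluent (T : finType) (e : rel T) (mu : T -> nat) :
  terminating e mu -> locally_confluent e -> confluent e.
Proof.
move=> term lc; split=> [a b ne [ab ba]|K].
  have := connect_mu term ab; have := connect_mu term ba.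
  rewrite eq_sym (negPf ne) /= => lt1 lt2.
  by have := ltn_trans lt1 lt2; rewrite ltnn.
case/imsetP=> x _ ->; have E := nform_sym term lc.
have /andP[_ nx] := nformP term x.
exists (nform e x); split=> [|m [_ hm]].
  split=> [|y]; first by rewrite !inE E (nform_terminal term nx) eqxx.
  by rewrite !inE E => /eqP ->; case/andP: (nformP term y).
have xm : connect e x m by apply: hm; rewrite !inE E eqxx.
rewrite (nform_connect term lc xm) (nform_terminal term) //.
(* A successor [z] of [m] stays in the component, hence leads back to [m], although [mu] has
   dropped. *)
apply/forallP => z; apply/negP => mz.
have zm : connect e z m by apply: hm; rewrite !inE E (nform_connect term lc xm)
  (nform_connect term lc (connect1 mz)) eqxx.
have := connect_mu term zm; have := term _ _ mz => lt1.
by case/orP=> [/eqP ezm|lt2]; [move: lt1;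
  rewrite ezm ltnn|have := ltn_trans lt1 lt2; rewrite ltnn].
Qed.

(** Each class contains exactly one terminal element, the common normal form of its members. *)
Lemma card_classes (T : finType) (e R : rel T) (mu : T -> nat) :
  terminating e mu -> (forall x y, R x y = (nform e x == nform e y)) ->
  #|equivalence_partition R [set: T]| = #|[set x | terminal e x]|.
Proof.
move=> term E.
have -> : equivalence_partition R [set: T] =
    (fun x => [set y | nform e x == nform e y]) @: [set x | terminal e x].
  apply/setP=> K; apply/imsetP/imsetP=> -[x _ ->].
    have /andP[_ nx] := nformP term x.
    exists (nform e x); first by rewrite inE.
    by apply/setP=> y; rewrite !inE E (nform_terminal term nx).
  by exists x => //; apply/setP=> y; rewrite !inE E.
rewrite card_in_imset // => x y; rewrite !inE => nx ny /setP/(_ y).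
by rewrite !inE eqxx !(nform_terminal term) // => /eqP.
Qed.

(** * Permutations and their words *)

Lemma word_iota n (w : 'S_n) : perm_eq (word w) (iota 1 n).
Proof.
rewrite /word -[1]addn0 iotaDl -val_enum_ord -map_comp.
rewrite (eq_map (g := (S \o val) \o w)) // map_comp -[X in perm_eq _ X]/(map (S
  \o val) _).
apply: perm_map; apply: uniq_perm; rewrite ?enum_uniq ?(map_inj_uniq perm_inj)
  ?enum_uniq //.
by move=> i; rewrite mem_enum; apply/mapP; exists ((w^-1)%g i);
  rewrite ?mem_enum ?permKV.
Qed.

Lemma size_word n (w : 'S_n) : size (word w) = n.
Proof. by rewrite (perm_size (word_iota w)) size_iota. Qed.

Lemma uniq_word n (w : 'S_n) : uniq (word w).
Proof. by rewrite (perm_uniq (word_iota w)) iota_uniq. Qed.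

Lemma nth_word n (w : 'S_n) (i : 'I_n) : nth 0 (word w) i = (w i).+1.
Proof. by rewrite (nth_map i) ?size_enum_ord // nth_ord_enum. Qed.

Lemma word_inj n : injective (@word n).
Proof.
move=> w w' e; apply/permP=> i; apply/val_inj.
by have := congr1 (fun s => nth 0 s i) e; rewrite !nth_word => -[].
Qed.

(** Inverse of [word] on rearrangements of 1, ..., n; any other sequence is sent to the identity. *)
Definition unword n (s : seq nat) : 'S_n := odflt 1%g [pick w | word w == s].

Lemma unwordK n (s : seq nat) : perm_eq s (iota 1 n) -> word (unword n s) = s.
Proof.
move=> ps; have ss : size s = n by rewrite (perm_size ps) size_iota.
have us : uniq s by rewrite (perm_uniq ps) iota_uniq.
pose f (i : 'I_n) : 'I_n := insubd i (nth 0 s i).-1.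
have sf (i : 'I_n) : (f i).+1 = nth 0 s i.
  have : nth 0 s i \in iota 1 n by rewrite -(perm_mem ps) mem_nth // ss.
  rewrite mem_iota => hi; rewrite val_insubd; case: ifP; clear - hi; lia.
have injf : injective f.
  have lt_s (k : 'I_n) : k < size s by rewrite ss.
  move=> i j eij; apply/val_inj/eqP; rewrite -(nth_uniq 0 (lt_s i) (lt_s j) us).
  by rewrite -!sf eij.
have wf : word (perm injf) = s.
  apply: (@eq_from_nth _ 0); rewrite size_word // => i lt_i.
  by rewrite (nth_word _ (Ordinal lt_i)) permE sf.
by rewrite /unword; case: pickP => [w /eqP //|/(_ (perm injf))];
  rewrite wf eqxx.
Qed.

Lemma wordK n (w : 'S_n) : unword n (word w) = w.
Proof. by apply: word_inj; rewrite unwordK ?word_iota. Qed.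

Lemma word_pats (u : 'S_3) : word u \in pats true.
Proof.
have h : all (mem (pats true)) (permutations (iota 1 3)) by vm_compute.
by apply: (allP h); rewrite mem_permutations word_iota.
Qed.

Lemma unword_pats (u : seq nat) : u \in pats true -> word (unword 3 u) = u.
Proof. by move=> hu; apply: unwordK; move: u hu; apply: pats_ind. Qed.

(** * The canonical straightening set *)

(** [pats true] and [pats false] list the patterns of a given leaning in the same relative order, so
    the two inequalities point in opposite directions. *)
Lemma pats_switch d (u v : seq nat) : u \in pats true -> v \in pats true ->
  (u \in inc_pats) = (v \in inc_pats) ->
  index u (pats d) <= index v (pats d) ->
  index v (pats (~~ d)) <= index u (pats (~~ d)) -> u = v.
Proof.
move=> hu hv e h1 h2; apply/eqP; move: u hu v hv e h1 h2.
by case: d; apply: pats_ind; apply: pats_ind.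
Qed.

(** If the choice made for the polarization [~~ d] has leaning [d], then so has the choice made for
    [d], and within one leaning the two preferences coincide. *)
Lemma nf_switch (T : eqType) (cl : seq nat -> T) d (u : seq nat) :
  u \in pats true -> (nf cl (~~ d) u \in inc_pats) = d ->
  nf cl (~~ d) u = nf cl d u.
Proof.
move=> hu e; have hn := nf_mem cl d hu; have hn' := nf_mem cl (~~ d) hu.
have e' := nf_lean hu hn' (nf_cl cl (~~ d) hu) e.
apply/esym; apply: (@pats_switch d); rewrite ?e' ?e //.
  by apply: nf_index; rewrite ?nf_cl.
by apply: nf_index; rewrite ?nf_cl.
Qed.

(* Membership in the straightening set does not mention the polarization: an
   element of the wrong leaning is straightened when its part leaves no choice.
   *)
Lemma straightened_pat (T : eqType) (cl : seq nat -> T) d (u : seq nat) :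
  u \in pats true ->
  (u == nf cl d u) =
  ((u == nf cl true u) || (u == nf cl false u)) &&
  (((u \in inc_pats) == d) ||
   ~~ has (fun v => (cl v == cl u) && ((v \in inc_pats) == d)) (pats true)).
Proof.
move=> hu; apply/idP/idP=> [/eqP e|].
  apply/andP; split; first by case: (d) e => e; rewrite -e eqxx ?orbT.
  rewrite orbC -implybE; apply/implyP => /hasP[v hv /andP[/eqP ev /eqP lv]].
  by rewrite {1}e (nf_lean hu hv ev lv).
case/andP=> hC hl.
have {hC} [//|e] : u == nf cl d u \/ u = nf cl (~~ d) u.
  by case: (d); case/orP: hC => /eqP h; [left|right|right|left]; rewrite // -h.
case/orP: hl => [/eqP lu|/hasPn hn].
  by rewrite -(nf_switch hu) -e.
have := hn _ (nf_mem cl d hu); rewrite nf_cl // eqxx /= => hl.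
have {}hl : (nf cl (~~ ~~ d) u \in inc_pats) = ~~ d.
  by move: hl; rewrite negbK; case: (_ \in _); case: (d).
by have := nf_switch hu hl; rewrite negbK -e => ->.
Qed.

(** * The notions of the statement expressed through patterns *)

Lemma tail_size_map (s : seq nat) k :
  tail_size [seq x + k | x <- s] = tail_size s.
Proof.
have es : sort leq [seq x + k | x <- s] = [seq x + k | x <- sort leq s].
  apply: (homo_sort_map (f := addn^~ k) (leT := leq)) => [x y|y x z| |x y] /=;
    rewrite ?leq_add2r //.
    exact: anti_leq.
  exact: leq_trans.
rewrite /tail_size size_map es; congr _.+1; apply: eq_find => j.
rewrite -!map_take; apply/idP/idP; last exact: perm_map.
exact: perm_map_inj (@addIn k) _ _.
Qed.

Lemma right_leaning_pats (u : seq nat) k : u \in pats true ->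
  right_leaning [seq x + k | x <- u] = (u \in inc_pats).
Proof.
rewrite /right_leaning tail_size_map size_map.
by move: u; apply: pats_ind; vm_compute.
Qed.

Lemma left_leaning_pats (u : seq nat) k : u \in pats true ->
  left_leaning [seq x + k | x <- u] = (u \notin inc_pats).
Proof.
rewrite /left_leaning -map_rev tail_size_map size_map.
by move: u; apply: pats_ind; vm_compute.
Qed.

Lemma factor3_pat (s : seq nat) i : hit s i ->
  factor3 s i = [seq x + base s i | x <- pat s i].
Proof. by move/factor3_hit->; apply: eq_map => x; rewrite addnC. Qed.

(** Every permutation of three letters leans in exactly one direction, so no hit is omni leaning. *)
Lemma forwardE (s : seq nat) i : hit s i ->
  forward s i = ((pat s i \in inc_pats) == right_polarized s i).
Proof.
move=> hs; have [_ hp] := andP hs.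
rewrite /forward /backward /left_polarized /omni_leaning factor3_pat //.
rewrite right_leaning_pats // left_leaning_pats //.
by case: (_ \in _); case: right_polarized.
Qed.

Lemma forms_hit (s : seq nat) i (u : 'S_3) :
  forms (factor3 s i) u = hit s i && (pat s i == word u).
Proof.
apply/formsP/andP=> [[k /(hit_factor3 (word_pats u))[hs -> _]]|[hs /eqP <-]] //.
by exists (base s i); apply: factor3_pat.
Qed.

Definition part_of (P : {set {set 'S_3}}) (u : seq nat) : {set 'S_3} :=
  pblock P (unword 3 u).

Lemma P_hitE (P : {set {set 'S_3}}) n (w : 'S_n) i :
  partition P [set: 'S_3] -> P_hit P w i = hit (word w) i.
Proof.
case/and3P=> /eqP hC _ _; apply/exists_inP/idP=> [[Q _ /exists_inP[u _]]|hs].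
  by rewrite forms_hit => /andP[].
have [_ hp] := andP hs.
exists (part_of P (pat (word w) i)); first by rewrite pblock_mem // hC.
apply/exists_inP; exists (unword 3 (pat (word w) i));
  first by rewrite mem_pblock hC.
by rewrite forms_hit hs unword_pats ?eqxx.
Qed.

(** Equal letter sums force equal bases, since all patterns have the same sum. *)
Lemma repl_base (s t : seq nat) i : hit s i -> hit t i ->
  take i t = take i s -> drop (i + 3) t = drop (i + 3) s ->
  perm_eq (factor3 t i) (factor3 s i) -> t = repl s i (pat t i).
Proof.
move=> hs ht et ed pf; have [_ hp] := andP hs; have [_ hq] := andP ht.
have eb : base t i = base s i.
  have := perm_sumn pf; rewrite !factor3_pat //.
  move: (pat s i) hp (pat t i) hq; apply: pats_ind; apply: pats_ind;
    rewrite /=; clear; lia.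
rewrite /repl -et -ed -eb; exact: esym (repl_pat ht).
Qed.

Lemma P_rearrangement_atP (P : {set {set 'S_3}}) n (w w' : 'S_n) i :
  partition P [set: 'S_3] ->
  reflect (hit (word w) i /\ exists2 v, v \in pats true &
     part_of P v = part_of P (pat (word w) i) /\ word w' = repl (word w) i v)
    (P_rearrangement_at P i w w').
Proof.
move=> hP; have [/eqP hC hT _] := and3P hP; apply: (iffP and4P).
  move=> [/eqP et /eqP ed pf /exists_inP[Q QP /exists_inP[u uQ /exists_inP[u'
    uQ']]]].
  rewrite !forms_hit => /andP[/andP[hs /eqP pu] /andP[hs' /eqP pu']].
  split=> //; exists (word u'); first exact: word_pats.
  split; last by rewrite -pu'; apply: repl_base.
  by rewrite /part_of pu !wordK (def_pblock hT QP uQ) (def_pblock hT QP uQ').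
move=> [hs [v hv [ev ew]]]; have [lt_i hp] := andP hs.
have [hs' ps bs] := hit_repl hs hv.
have st : size (take i (word w)) = i by rewrite size_takel //;
  apply: ltnW (ltnW (ltnW lt_i)).
split.
- by rewrite ew /repl take_size_cat.
- rewrite ew /repl catA drop_size_cat // size_cat st size_map.
  by rewrite (size_pats hv).
- rewrite ew !factor3_pat // ps bs; apply: perm_map.
  move: {ew bs ps hs' ev} v hv; move: {st hs} (pat _ _) hp.
  by apply: pats_ind; apply: pats_ind.
apply/exists_inP; exists (part_of P (pat (word w) i));
  first by rewrite pblock_mem // hC.
apply/exists_inP; exists (unword 3 (pat (word w) i));
  first by rewrite mem_pblock hC.
apply/exists_inP; exists (unword 3 v); first by rewrite -ev mem_pblock hC.
by rewrite !forms_hit ew hs hs' ps !unword_pats // !eqxx.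
Qed.

(** The set collects the representatives chosen for both polarizations. *)
Definition canonical_straightening (P : {set {set 'S_3}}) : {set 'S_3} :=
  [set u | [exists d, word u == nf (part_of P) d (word u)]].

Lemma mem_canonical (P : {set {set 'S_3}}) (u : 'S_3) :
  (u \in canonical_straightening P) =
  (word u == nf (part_of P) true (word u)) || (word u == nf (part_of P) false
    (word u)).
Proof.
rewrite inE; apply/existsP/orP=> [[[] h]|[] h];
  by [left|right|exists true|exists false].
Qed.

Lemma perm_repl_word n (w : 'S_n) i (v : seq nat) :
  hit (word w) i -> v \in pats true -> word (unword n (repl (word w) i v)) =
    repl (word w) i v.
Proof.
by move=> hs hv; apply/unwordK/(perm_trans (perm_repl hs hv))/word_iota.
Qed.

(** Rearranging a hit keeps its polarization, so a forward rearrangement exists exactly when the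
    part contains a pattern whose leaning matches it. This is the alternative isolated in
    [straightened_pat]. *)
Lemma straightenedE (P : {set {set 'S_3}}) n (w : 'S_n) i :
  partition P [set: 'S_3] ->
  straightened P (canonical_straightening P) w i =
  hit (word w) i && (pat (word w) i == nf_at (part_of P) (word w) i).
Proof.
move=> hP; rewrite /straightened P_hitE //; have [hs|//] := boolP (hit _ _).
have [_ hp] := andP hs.
rewrite /= straightened_pat //; congr (_ && _).
  have := mem_canonical P (unword 3 (pat (word w) i));
    rewrite unword_pats // => <-.
  apply/exists_inP/idP=> [[u uC]|hC].
    by rewrite forms_hit => /andP[_ /eqP ->]; rewrite wordK.
  by exists (unword 3 (pat (word w) i));
    rewrite // forms_hit hs unword_pats ?eqxx.
have eb : backward (word w) i = ~~ forward (word w) i by rewrite /forward negbK.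
rewrite -(forwardE hs) eb; case: (forward (word w) i) => //;
  rewrite !orFb andTb; congr (~~ _).
apply/existsP/hasP=> [[w' /andP[/(P_rearrangement_atP _ _ _ hP)[_ [v hv [ev
  ew]]]]]|].
  have [hs' ps _] := hit_repl hs hv.
  rewrite ew forwardE // ps right_polarized_repl // => hl.
  by exists v; rewrite ?ev ?eqxx.
move=> [v hv /andP[/eqP ev lv]]; have [hs' ps _] := hit_repl hs hv.
exists (unword n (repl (word w) i v)); apply/andP; split; last first.
  by rewrite perm_repl_word // forwardE // ps right_polarized_repl.
apply/P_rearrangement_atP => //; split=> //; exists v => //; split=> //.
exact: perm_repl_word.
Qed.

(** A straightened rearrangement is unique: its pattern is the normal form, which depends only on
    the part and the polarization, and both are preserved. *)
Lemma straighteningP (P : {set {set 'S_3}}) n (w w' : 'S_n) :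
  partition P [set: 'S_3] ->
  reflect (exists i, bad (part_of P) (word w) i /\ word w' =
    straighten (part_of P) (word w) i)
          (straightening P (canonical_straightening P) w w').
Proof.
move=> hP; apply: (iffP existsP) => [[i]|[i [bi ew]]].
  rewrite P_hitE // !straightenedE // => /and4P[hs ns].
  move=> /(P_rearrangement_atP _ _ _ hP)[_ [v hv [ev ew]]] /andP[_ /eqP sw].
  exists i; rewrite /bad hs; split; first by move: ns; rewrite hs.
  have [hs' ps _] := hit_repl hs hv; have [_ hp] := andP hs.
  move: sw; rewrite ew /nf_at ps right_polarized_repl // => sw.
  by rewrite /straighten /nf_at -(nf_eq _ hv ev) -sw.
have [hs ne] := andP bi; have [lt_i hp] := andP hs.
have lt_n : i < n by rewrite -(size_word w); exact: ltnW (ltnW lt_i).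
have hn : nf_at (part_of P) (word w) i \in pats true by apply: nf_mem.
have [hs' ps _] := hit_repl hs hn.
exists (Ordinal lt_n); rewrite P_hitE // !straightenedE //= hs ne /=.
apply/andP; split.
  apply/P_rearrangement_atP => //; split=> //.
  by exists (nf_at (part_of P) (word w) i) => //; rewrite nf_cl.
have e : nf_at (part_of P) (straighten (part_of P) (word w) i) i =
  nf_at (part_of P) (word w) i.
  rewrite {1}/nf_at /straighten ps right_polarized_repl //.
  by apply: nf_eq => //; apply: nf_cl.
by rewrite ew e hs' ps /=.
Qed.

Lemma straightening_terminating (P : {set {set 'S_3}}) n :
  partition P [set: 'S_3] ->
  terminating (@straightening P (canonical_straightening P) n)
    (fun w => potential n (word w)).
Proof.
move=> hP w w' /(straighteningP _ _ hP)[i [bi ->]].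
by apply: potential_straighten; rewrite ?word_iota.
Qed.

Lemma straightening_locally_confluent (P : {set {set 'S_3}}) n :
  partition P [set: 'S_3] ->
  locally_confluent (@straightening P (canonical_straightening P) n).
Proof.
move=> hP w y z /(straighteningP _ _ hP)[i [bi ey]] /(straighteningP _ _ hP)[j
  [bj ez]].
wlog lt_ij : i j y z bi bj ey ez / i < j.
  move=> H; case: (ltngtP i j) => [lt_ij|lt_ji|e]; first exact: (H i j).
    by have [t zt yt] := H j i z y bj bi ez ey lt_ji; exists t.
  by subst j; exists y => //; rewrite (_ : z = y) //; apply: word_inj;
    rewrite ey ez.
have us := uniq_word w.
case: (straighten_confluent us bi bj lt_ij) => [e|[bj' bi' e]].
  by exists y => //; rewrite (_ : z = y) //; apply: word_inj; rewrite ey ez e.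
have hj := andP bj'; have [hj' _] := hj; have [_ hpj] := andP hj'.
rewrite -ey in bj' e hj' hpj; rewrite -ez in bi' e.
exists (unword n (straighten (part_of P) (word y) j)); apply: connect1.
  apply/straighteningP => //; exists j; split=> //.
  by apply: perm_repl_word => //; apply: nf_mem.
apply/straighteningP => //; exists i; split=> //.
by rewrite -e; apply: perm_repl_word => //; apply: nf_mem.
Qed.

Lemma canonical_straightening_set (P : {set {set 'S_3}}) :
  partition P [set: 'S_3] -> straightening_set P (canonical_straightening P).
Proof.
move=> hP; have [/eqP hC hT hn] := and3P hP; split=> [|Q QP].
  by rewrite hC; apply: subsetT.
have Qp (u : 'S_3) : u \in Q -> part_of P (word u) = Q.
  by move=> uQ; rewrite /part_of wordK; apply: def_pblock.
have pQ (u : seq nat) : part_of P u = Q -> unword 3 u \in Q.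
  by move=> <-; rewrite mem_pblock hC.
have lean d : #|[set u in canonical_straightening P :&:
  Q | (word u \in inc_pats) == d]|
     = [exists u in Q, (word u \in inc_pats) == d] :> nat.
  case: exists_inP => [[u0 uQ /eqP lu]|no] /=; last first.
    apply: eq_card0 => u; rewrite in_set in_setI;
      apply/negP => /andP[/andP[_ uQ] lu].
    by apply: no; exists u.
  have hu0 := word_pats u0.
  have hm := nf_mem (part_of P) d hu0.
  apply/eqP/cards1P; exists (unword 3 (nf (part_of P) d (word u0))).
  apply/setP=> u; rewrite in_set in_setI mem_canonical in_set1.
  apply/andP/eqP => [[/andP[hu uQ'] /eqP lu']|->].
    have hw := word_pats u; apply: word_inj; rewrite unword_pats //.
    rewrite -(nf_eq d hw); last by rewrite !Qp.
    (* Uniqueness: a member of leaning [d] chosen for the other polarization is also the one chosen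
       for [d]. *)
    have [//|h] : word u = nf (part_of P) d (word u) \/ word u =
      nf (part_of P) (~~ d) (word u).
      by case: (d); case/orP: hu => /eqP h; [left|right|right|left].
    by rewrite -(nf_switch hw) -?h.
  rewrite unword_pats // (nf_lean hu0 hu0 erefl lu) eqxx; split=> //;
    apply/andP; split; last first.
    by apply: pQ; rewrite nf_cl // Qp.
  have e : nf (part_of P) d (nf (part_of P) d (word u0)) =
    nf (part_of P) d (word u0).
    by apply: nf_eq => //; apply: nf_cl.
  by case: (d) e => ->; rewrite eqxx ?orbT.
have ll (u : 'S_3) : left_leaning (word u) = ((word u \in inc_pats) == false).
  by rewrite -[in LHS](map_id (word u)) -(eq_map addn0) left_leaning_pats
    ?word_pats // eqbF_neg.
have rl (u : 'S_3) : right_leaning (word u) = ((word u \in inc_pats) == true).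
  by rewrite -[in LHS](map_id (word u)) -(eq_map addn0) right_leaning_pats
    ?word_pats // eqb_id.
split.
- rewrite (eq_card (B := mem [set u in canonical_straightening P :&:
  Q | (word u \in inc_pats) == false])).
    by rewrite lean; congr nat_of_bool; apply: eq_existsb => u; rewrite ll.
  by move=> u; rewrite !in_set ll.
- rewrite (eq_card (B := mem [set u in canonical_straightening P :&:
  Q | (word u \in inc_pats) == true])).
    by rewrite lean; congr nat_of_bool; apply: eq_existsb => u; rewrite rl.
  by move=> u; rewrite !in_set rl.
have om (u : 'S_3) : omni_leaning (word u) = false.
  by rewrite /omni_leaning ll rl; case: (_ \in _).
have [u uQ] : exists u, u \in Q by apply/set0Pn; apply: contraNneq hn => <-.
have -> : [forall u in Q, omni_leaning (word u)] = false.
  by apply/negP => /forall_inP /(_ u uQ); rewrite om.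
by apply: eq_card0 => v; rewrite !inE om andbF.
Qed.

(** * Counting *)

Import GRing.Theory.
Local Open Scope ring_scope.

(** All sets of starting positions of disjoint windows of length 3 in [n] cells, as decreasing
    lists. For [n = m + 3] the last possible start [m] is either left out or followed by a choice
    within the first [m] cells. *)
Fixpoint spaced (n : nat) : seq (seq nat) :=
  match n with
  | S ((S (S m)) as m2) => spaced m2 ++ [seq m :: J | J <- spaced m]
  | _ => [:: [::]]
  end.

Fixpoint fits (n : nat) (J : seq nat) : bool :=
  if J is i :: J' then (i + 3 <= n)%N && fits i J' else true.

Lemma fitsW (m n : nat) (J : seq nat) : (m <= n)%N -> fits m J -> fits n J.
Proof. by case: J => //= i J le_mn /andP[le_i ->]; rewrite (leq_trans le_i).
Qed.

Lemma spaced_fits n (J : seq nat) : J \in spaced n -> fits n J.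
Proof.
have [m] := ubnP n; elim: m n J => // m IHm [|[|[|n]]] J lt_n;
  try by rewrite inE => /eqP->.
rewrite mem_cat => /orP[hJ|/mapP[J' hJ' ->]].
  by apply: (@fitsW n.+2); last exact: IHm n.+2 J lt_n hJ.
rewrite /= addn3 leqnn /=; apply: (IHm n J' _ hJ').
by exact: ltnW (ltnW (lt_n : (n.+2 < m)%N)).
Qed.

(** Contracting each window to one cell leaves a choice of [j] cells among [n - 2 * j]; the
    recursion of [spaced] is Pascal's rule. *)
Lemma count_spaced n j :
  count (fun J => size J == j) (spaced n) =
  (if (3 * j <= n)%N then 'C(n - 2 * j, j) else 0)%N.
Proof.
have [m] := ubnP n; elim: m n j => // m IHm [|[|[|n]]] j lt_n;
  try by case: j => [|j] //; rewrite ifF //; clear; lia.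
rewrite -[spaced _]/(spaced n.+2 ++ [seq n :: J | J <- spaced n]).
rewrite count_cat count_map IHm //.
case: j => [|j].
  by rewrite muln0 !bin0 (eq_count (a2 := pred0)) ?count_pred0.
rewrite (eq_count (a2 := fun J => size J == j)) //.
rewrite IHm; last by exact: ltnW (ltnW (lt_n : (n.+2 < m)%N)).
have [le_j|lt_j] := leqP (3 * j)%N n; last by rewrite !ifF //; clear - lt_j;
  lia.
rewrite [in RHS]ifT; last by clear - le_j; lia.
have -> : (n.+3 - 2 * j.+1 = (n - 2 * j).+1)%N by clear - le_j; lia.
have -> : (n.+2 - 2 * j.+1 = n - 2 * j)%N by clear; lia.
(* The first summand drops out only for [n = 3 * j], where the corresponding binomial coefficient
   vanishes too. *)
rewrite binS; case: ifP => // lt_n3; rewrite [in RHS]bin_small //.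
by clear - le_j lt_n3; lia.
Qed.

Lemma spaced_size n (J : seq nat) : J \in spaced n -> (3 * size J <= n)%N.
Proof.
move=> hJ; have : (0 < count (fun K => size K == size J) (spaced n))%N.
  by rewrite -has_count; apply/hasP; exists J.
by rewrite count_spaced; case: ifP.
Qed.

Lemma sum_spaced (R : nzRingType) (F : nat -> R) n :
  \sum_(J <- spaced n) F (size J) =
  \sum_(0 <= j < n.+1 | (3 * j <= n)%N) 'C(n - 2 * j, j)%:R * F j.
Proof.
have H (s : seq (seq nat)) : all (fun J => (size J < n.+1)%N) s ->
    \sum_(J <- s) F (size J) =
    \sum_(0 <= j < n.+1) (count (fun J => size J == j) s)%:R * F j.
  elim: s => [|J s IHs] /=; first by rewrite big_nil big1 // => j _;
    rewrite mul0r.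
  case/andP=> lt_J /IHs; rewrite big_cons => ->.
  under [RHS]eq_bigr => j _ do rewrite natrD mulrDl.
  rewrite big_split /=; congr (_ + _).
  rewrite big_mkord (bigD1 (Ordinal lt_J)) //= eqxx mul1r big1 ?addr0 // => j
    nj.
  by rewrite (_ : size J == j = false) ?mul0r //; apply: contraNF nj => /eqP e;
    apply/eqP/val_inj.
rewrite H; last first.
  by apply/allP=> J /spaced_size; clear; lia.
rewrite [RHS]big_mkcond; apply: eq_bigr => j _.
by rewrite count_spaced; case: ifP => // _; rewrite mul0r.
Qed.

(* A bad position excludes bad positions at distance 1 and 2, so only the sets
   of positions listed by [spaced] survive in the inclusion-exclusion formula.
   *)
Lemma spaced_sieve (R : nzRingType) (b : pred nat) :
  (forall i j, (i < j)%N -> b i -> b j -> (i + 3 <= j)%N) ->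
  forall n, (all (fun i => ~~ b i) (iota 0 (n - 2)))%:R =
    \sum_(J <- spaced n) (-1) ^+ size J * (all b J)%:R :> R.
Proof.
move=> hb n; have [m] := ubnP n; elim: m n => // m IHm [|[|[|n]]] lt_n;
  try by rewrite big_seq1 mul1r.
rewrite -[spaced _]/(spaced n.+2 ++ [seq n :: J | J <- spaced n]).
rewrite big_cat big_map -IHm //.
have lt_m : (n < m)%N by exact: ltnW (ltnW (lt_n : (n.+2 < m)%N)).
transitivity ((all (fun i => ~~ b i) (iota 0 (n.+2 - 2)))%:R
   - (b n)%:R * (all (fun i => ~~ b i) (iota 0 (n - 2)))%:R : R); last first.
  congr (_ + _); rewrite (IHm n) // mulr_sumr -sumrN; apply: eq_bigr => J _.
  rewrite exprS mulN1r mulNr; congr (- _).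
  rewrite -[all b (n :: J)]/(b n && all b J).
  by case: (b n); rewrite ?mulr0n ?mulr1n ?mul0r ?mulr0 ?mul1r.
rewrite !subSS !subn0 -[n.+1]addn1 iotaD all_cat /= andbT add0n.
have [bn|nbn] /= := boolP (b n); last by rewrite andbT mul0r subr0.
(* When [n] is bad, the two positions before it are not, so testing them adds nothing. *)
rewrite andbF mul1r; apply/esym/eqP; rewrite subr_eq0; apply/eqP; congr (_%:R).
case: n bn {lt_n lt_m} => [|[|n]] bn //.
  by rewrite /=; have := hb 0%N 1%N isT; rewrite bn;
    case: (b 0%N) => // /(_ isT isT).
rewrite !subSS subn0 -[n.+2]addn2 iotaD all_cat /= add0n.
have -> : b n = false by apply/negP=> bi;
  have := hb n n.+2 (leqW (leqnn _)) bi bn; clear; lia.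
have -> : b n.+1 = false by apply/negP=> bi;
  have := hb n.+1 n.+2 (leqnn _) bi bn; clear; lia.
by rewrite /= andbT.
Qed.

(** * Permutations with prescribed consecutive successors *)

Definition link (s : seq nat) (p : nat) : bool := nth 0%N s p.+1 == (nth 0%N s
  p).+1.

Fixpoint descending (m : nat) (T : seq nat) : bool :=
  if T is p :: T' then (p < m)%N && descending p T' else true.

Lemma descendingW (m n : nat) (T : seq nat) :
  (m <= n)%N -> descending m T -> descending n T.
Proof. by case: T => //= i J le_mn /andP[le_i ->]; rewrite (leq_trans le_i).
Qed.

Lemma descending_lt m (T : seq nat) : descending m T ->
  all (fun q => (q < m)%N) T.
Proof.
elim: T m => //= p T IHT m /andP[lt_p /IHT hT]; rewrite lt_p /=.
by apply: sub_all hT => q lt_q; apply: ltn_trans lt_p.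
Qed.

(** The letter at position [p] is inflated to a run of two: its successor is inserted at position
    [p + 1] and larger letters are raised by one. *)
Definition insert_after n (p : 'I_n.+1) (s : 'S_n.+1) : 'S_n.+2 :=
  lift_perm (lift ord0 p) (lift ord0 (s p)) s.

Lemma lift_lt n (p q : 'I_n.+1) : (q <= p)%N -> lift (lift ord0 p) q = q :> nat.
Proof. by rewrite /= /bump /= add1n => le_q; rewrite ltnNge le_q. Qed.

Lemma insert_afterE n (p : 'I_n.+1) (s : 'S_n.+1) (q : nat) : (q <= p)%N ->
  nth 0%N (word (insert_after p s)) q =
  (nth 0 (word s) q + (nth 0 (word s) p < nth 0 (word s) q))%N.
Proof.
move=> le_q; have lt_q : (q < n.+1)%N by apply: leq_ltn_trans (ltn_ord p).
have e : q = lift (lift ord0 p) (Ordinal lt_q) by rewrite lift_lt.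
rewrite {1}e nth_word lift_perm_lift (nth_word s p) (nth_word s (Ordinal lt_q)).
by rewrite /= /bump /= add1n addnC addSn ltnS.
Qed.

Lemma insert_after_succ n (p : 'I_n.+1) (s : 'S_n.+1) :
  nth 0%N (word (insert_after p s)) p.+1 = (nth 0 (word s) p).+1.
Proof.
have e : p.+1 = lift ord0 p by rewrite /= /bump /= add1n.
by rewrite e nth_word lift_perm_id nth_word /= /bump /= add1n.
Qed.

(** Raising the letters above [s p] can alter a link only if its first letter is [s p] itself, which
    is excluded by [q < p]. *)
Lemma insert_after_link n (p : 'I_n.+1) (s : 'S_n.+1) (q : nat) : (q < p)%N ->
  link (word (insert_after p s)) q = link (word s) q.
Proof.
move=> lt_q; rewrite /link !insert_afterE //; last exact: ltnW.
have ne : nth 0%N (word s) q != nth 0%N (word s) p.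
  rewrite nth_uniq ?size_word ?uniq_word //; first by rewrite (ltn_eqF lt_q).
  by apply: ltn_trans lt_q (ltn_ord p).
move: ne; move: (nth _ _ q) (nth _ _ q.+1) (nth _ _ p) => a b c.
by clear; lia.
Qed.

Lemma insert_after_inj n (p : 'I_n.+1) : injective (insert_after p).
Proof.
move=> s t est; apply/permP=> k.
have ep : s p = t p.
  have := congr1 (fun w : 'S_n.+2 => w (lift ord0 p)) est.
  by rewrite /insert_after !lift_perm_id => /lift_inj.
have := congr1 (fun w : 'S_n.+2 => w (lift (lift ord0 p) k)) est.
by rewrite /insert_after !lift_perm_lift ep => /lift_inj.
Qed.

(** The preimage is obtained by deleting the letter at position [p + 1] and closing the gap in
    values. *)
Lemma insert_after_onto n (p : 'I_n.+1) (w : 'S_n.+2) :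
  link (word w) p -> exists s, w = insert_after p s.
Proof.
set p1 := lift ord0 p; move=> lw.
have ne k : w p1 != w (lift p1 k) by rewrite (inj_eq perm_inj) neq_lift.
pose f k := s2val (unlift_some (ne k)).
have fE k : w (lift p1 k) = lift (w p1) (f k)
  by apply: (s2valP (unlift_some (ne k))).
have injf : injective f.
  by move=> i j e; apply: (@lift_inj _ p1); apply: (@perm_inj _ w);
    rewrite !fE e.
exists (perm injf).
have wp : lift ord0 (perm injf p) = w p1.
  apply/val_inj; rewrite permE; have := fE p => /(congr1 val) /=.
  move: lw; rewrite /link.
  have -> : nth 0%N (word w) p.+1 = (w p1).+1.
    by rewrite -nth_word /p1 /= /bump /= add1n.
  have -> : nth 0%N (word w) p = (w (lift p1 p)).+1.
    by rewrite -nth_word /p1 lift_lt.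
  rewrite eqSS => /eqP ->; rewrite /= /bump; clear.
  by move: (nat_of_ord (f p)) (nat_of_ord (w (lift p1 p))) => x y; lia.
apply/permP=> k; rewrite /insert_after wp.
case: (unliftP p1 k) => [j|] ->; first by rewrite lift_perm_lift permE fE.
by rewrite lift_perm_id.
Qed.

(** Contracting the rightmost link shortens the permutation by one letter and, as the list is
    descending, leaves the remaining links intact. *)
Lemma card_links n (T : seq nat) : descending n T ->
  #|[set w : 'S_n.+1 | all (link (word w)) T]| = (n.+1 - size T)`!.
Proof.
elim: T n => [|p T IHT] n /=.
  move=> _; rewrite subn0 -card_Sn; apply: eq_card => w.
  by rewrite !inE.
case/andP=> lt_p dT; case: n lt_p => // n lt_p.
have -> : [set w : 'S_n.+2 | link (word w) p && all (link (word w)) T] =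
   insert_after (Ordinal lt_p) @: [set s : 'S_n.+1 | all (link (word s)) T].
  have E s : all (link (word (insert_after (Ordinal lt_p) s))) T =
    all (link (word s)) T.
    apply: eq_in_all => q /(allP (descending_lt dT)) lt_q.
    exact: insert_after_link.
  apply/setP=> w; rewrite inE; apply/andP/imsetP=> [[lp lT]|[s]].
    have [s ew] := @insert_after_onto n (Ordinal lt_p) w lp.
    by exists s; rewrite // inE -E -ew.
  rewrite inE => lT ->; rewrite E lT; split=> //.
  by rewrite /link (insert_after_succ (Ordinal lt_p)) insert_afterE // ltnn
    addn0.
rewrite card_imset; last exact: insert_after_inj.
by rewrite IHT //; apply: descendingW dT.
Qed.

(** * Counting words with unstraightened hits at given positions *)

Definition apart (i j : nat) : bool := ((i + 3 <= j) || (j + 3 <= i))%N.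

Definition topped (s : seq nat) (i : nat) : bool :=
  hit s i && (pat s i == top true).

Lemma bad_repl (T : eqType) (cl : seq nat -> T) (s : seq nat) i j (u :
  seq nat) :
  uniq s -> hit s i -> u \in pats true -> apart i j ->
  bad cl (repl s i u) j = bad cl s j.
Proof.
move=> us hi hu dij; have [hj pj _] := hit_repl_disjoint hi hu dij.
rewrite /bad hj; have [hs /=|//] := boolP (hit s j).
by rewrite /nf_at pj right_polarized_repl_disjoint.
Qed.

Lemma topped_repl (s : seq nat) i j (u : seq nat) :
  hit s i -> u \in pats true -> apart i j -> topped (repl s i u) j = topped s j.
Proof.
by move=> hi hu dij; have [hj pj _] := hit_repl_disjoint hi hu dij;
  rewrite /topped hj pj.
Qed.

Lemma repl_inj (s : seq nat) i : (i.+2 < size s)%N ->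
  {in pats true &, injective (repl s i)}.
Proof.
move=> lt_i u v hu hv e; apply: (@eq_from_nth _ 0%N);
  rewrite !size_pats // => c lt_c.
have := congr1 (fun t => nth 0%N t (i + c)%N) e.
by rewrite /= !nth_repl ?(size_pats hu) ?(size_pats hv) // leq_addr ltn_add2l
  lt_c addKn => /addnI.
Qed.

(** Replacing the hit at [i] by an increasing run preserves its polarization and all conditions at
    positions apart from [i]. Each fibre is indexed by the patterns that are not normal for that
    polarization, and there are [k] of them in either case. *)
Lemma card_bad_step (T : eqType) (cl : seq nat -> T) (k n : nat) (A J :
  seq nat) i :
  (forall d, count (fun u => u != nf cl d u) (pats true) = k) ->
  all (apart i) A -> all (apart i) J ->
  #|[set w : 'S_n | all (bad cl (word w)) (i :: A) &&
    all (topped (word w)) J]| =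
  (k * #|[set w : 'S_n | all (bad cl (word w)) A && all (topped (word w)) (i ::
    J)]|)%N.
Proof.
move=> hk iA iJ; set X := [set w | _]; set Y := [set w | _ & _].
pose f (w : 'S_n) : 'S_n := unword n (repl (word w) i (top true)).
have ht : top true \in pats true by [].
have hX w : (w \in X) = [&& bad cl (word w) i, all (bad cl (word w)) A & all
  (topped (word w)) J].
  by rewrite inE /= andbA.
have hY w : (w \in Y) = [&& topped (word w) i, all (bad cl (word w)) A & all
  (topped (word w)) J].
  by rewrite inE /= andbCA.
have inv (w : 'S_n) u : hit (word w) i -> u \in pats true ->
   all (bad cl (repl (word w) i u)) A = all (bad cl (word w)) A /\
   all (topped (repl (word w) i u)) J = all (topped (word w)) J.
  move=> hw hu; split; apply: eq_in_all => j hj.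
    by apply: bad_repl; rewrite ?uniq_word // (allP iA).
  by apply: topped_repl => //; apply: (allP iJ).
have fXY w : w \in X -> f w \in Y.
  rewrite hX hY => /and3P[/andP[hw _] wA wJ].
  have [eA eJ] := inv w _ hw ht; have [hs' ps _] := hit_repl hw ht.
  by rewrite /f !perm_repl_word // eA eJ wA wJ /topped hs' ps eqxx.
have fiber w : w \in Y -> #|[set v in X | f v == w]| = k.
  rewrite hY => /and3P[/andP[hw /eqP pw] wA wJ].
  have [lt_i _] := andP hw.
  pose g u : 'S_n := unword n (repl (word w) i u).
  have wg u : u \in pats true -> word (g u) = repl (word w) i u
    by exact: perm_repl_word.
  pose B := [seq u <- pats true | u != nf cl (right_polarized (word w) i) u].
  have hB u : u \in B -> u \in pats true by rewrite mem_filter => /andP[].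
  have ug : uniq [seq g u | u <- B].
    rewrite map_inj_in_uniq ?filter_uniq // => u v /hB hu /hB hv /(congr1 (@word
      n)).
    by rewrite !wg //; apply: repl_inj.
  rewrite -(hk (right_polarized (word w) i)) -size_filter -/B -(size_map g)
    -(card_uniqP ug).
  apply: eq_card => v; rewrite in_set hX; apply/andP/mapP.
    move=> [/and3P[/andP[hv bv] _ _] /eqP efv].
    have ew : word w = repl (word v) i (top true)
      by rewrite -efv perm_repl_word.
    have [_ hp] := andP hv.
    exists (pat (word v) i).
      by rewrite mem_filter hp andbT ew right_polarized_repl.
    by apply: word_inj; rewrite wg // ew repl_repl // repl_pat.
  case=> u uB ->; have hu := hB u uB; have [hs' ps _] := hit_repl hw hu.
  have [eA eJ] := inv w u hw hu.
  move: uB; rewrite mem_filter => /andP[bu _].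
  rewrite !wg // eA eJ wA wJ /bad hs' /nf_at ps right_polarized_repl // bu;
    split=> //.
  by apply/eqP/word_inj; rewrite /f perm_repl_word ?wg // repl_repl // -pw
    repl_pat.
rewrite -sum1_card (partition_big f (mem Y)) //= mulnC -sum_nat_const.
apply: eq_bigr => w hw; rewrite -(fiber w hw) -sum1_card; apply: eq_bigl => v.
by rewrite in_set.
Qed.

(** The accumulator of [catrev] holds the positions still bad, which lets the induction move the
    positions of [J] one by one to increasing runs. *)
Lemma card_bad_catrev (T : eqType) (cl : seq nat -> T) (k n : nat) (A J :
  seq nat) :
  (forall d, count (fun u => u != nf cl d u) (pats true) = k) ->
  pairwise apart J -> allrel apart J A ->
  #|[set w : 'S_n | all (bad cl (word w)) (catrev J A)]| =
  (k ^ size J * #|[set w : 'S_n | all (bad cl (word w)) A &&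
    all (topped (word w)) J]|)%N.
Proof.
move=> hk; elim: J A => [|i J IHJ] A /=.
  by move=> _ _; rewrite mul1n; apply: eq_card => w; rewrite !inE andbT.
rewrite allrel_consl => /andP[iJ pJ] /andP[iA JA].
rewrite IHJ //; first by rewrite (card_bad_step n hk iA iJ) expnSr mulnA.
rewrite allrel_consr JA andbT; apply: sub_all iJ => j.
by rewrite /apart orbC.
Qed.

Lemma topped_link n (w : 'S_n) i : (i + 3 <= n)%N ->
  topped (word w) i = link (word w) i.+1 && link (word w) i.
Proof.
move=> le_i; have lt_i : (i.+2 < size (word w))%N by rewrite size_word;
  clear - le_i; lia.
have pos : (0 < nth 0 (word w) i)%N.
  have : nth 0%N (word w) i \in word w by rewrite mem_nth //;
    exact: ltnW (ltnW lt_i).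
  by rewrite (perm_mem (word_iota w)) mem_iota => /andP[].
apply/andP/andP=> [[hw /eqP pw]|[/eqP e2 /eqP e1]].
  by have [h0 h1 h2] := hit_nths hw; rewrite /link h0 h1 h2 pw /= !addnS !eqxx.
have h0 : nth 0%N (word w) i = ((nth 0 (word w) i).-1 + 1)%N
  by rewrite addn1 prednK.
have h1 : nth 0%N (word w) i.+1 = ((nth 0 (word w) i).-1 + 2)%N
  by rewrite addn2 prednK.
have h2 : nth 0%N (word w) i.+2 = ((nth 0 (word w) i).-1 + 3)%N
  by rewrite addn3 prednK // e2 e1.
by have [-> ->] := @hit_intro _ _ (top true) _ lt_i isT h0 h1 h2.
Qed.

Lemma fits_all n (J : seq nat) : fits n J -> all (fun i => (i + 3 <= n)%N) J.
Proof.
elim: J n => //= i J IHJ n /andP[le_i /IHJ h]; rewrite le_i /=.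
by apply: sub_all h => j; move: le_i; clear; lia.
Qed.

Lemma fits_apart n (J : seq nat) : fits n J -> pairwise apart J.
Proof.
elim: J n => //= i J IHJ n /andP[_ fJ]; rewrite (IHJ i) // andbT.
by apply: sub_all (fits_all fJ) => j; rewrite /apart => ->; rewrite orbT.
Qed.

(** An increasing run at [i] amounts to links at [i + 1] and [i], so [J] turns into a descending
    list of twice its size. *)
Lemma card_topped n (J : seq nat) : fits n.+1 J ->
  #|[set w : 'S_n.+1 | all (topped (word w)) J]| = (n.+1 - 2 * size J)`!.
Proof.
move=> fJ; pose T := flatten [seq [:: i.+1; i] | i <- J].
have sT : size T = (2 * size J)%N.
  by rewrite /T; elim: (J) => //= i J' ->; clear; lia.
have dT : descending n T.
  rewrite /T; elim: J (n) fJ {T sT} => //= i J IHJ m /andP[le_i fJ].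
  apply/and3P; split=> //; first by clear - le_i; lia.
  (* The induction pairs [fits m.+1] with [descending m]; for [i = 0] no further window fits and the
     rest of the list is empty. *)
  by case: i fJ {le_i} => [|i] fJ; [case: (J) fJ => //= j J' /andP[]; clear;
    lia|exact: descendingW (leqnSn i) (IHJ i fJ)].
rewrite -sT -card_links //; apply: eq_card => w; rewrite !inE /T.
elim: (J) (fits_all fJ) => //= i J' IHJ /andP[le_i /IHJ ->].
by rewrite topped_link // andbA.
Qed.

Lemma card_bad (T : eqType) (cl : seq nat -> T) (k n : nat) (J : seq nat) :
  (forall d, count (fun u => u != nf cl d u) (pats true) = k) ->
  fits n.+1 J ->
  #|[set w : 'S_n.+1 | all (bad cl (word w)) J]| = (k ^ size J * (n.+1 - 2
    * size J)`!)%N.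
Proof.
move=> hk fJ; rewrite -card_topped // -[in LHS](revK J).
have e (w : 'S_n.+1) : all (bad cl (word w)) (rev (rev J)) =
  all (bad cl (word w)) (catrev J [::]).
  by rewrite revK -[catrev _ _]/(rev J) all_rev.
rewrite (eq_card (B := mem [set w : 'S_n.+1 | all (bad cl (word w)) (catrev J
  [::])])); last first.
  by move=> w; rewrite !in_set e.
rewrite (card_bad_catrev _ hk) ?(fits_apart fJ) //; last by rewrite allrel0r.
Qed.

Lemma bad_apart (T : eqType) (cl : seq nat -> T) (s : seq nat) i j :
  (forall d, ~~ ((cl (mid d) == cl (top d)) && (cl (low d) == cl (top d)))) ->
  uniq s -> (i < j)%N -> bad cl s i -> bad cl s j -> (i + 3 <= j)%N.
Proof.
move=> hB us lt_ij bi bj; rewrite leqNgt; apply/negP => lt_j.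
have [d [em el _ _]] := bad_overlap us bi bj lt_ij lt_j.
by have := hB d; rewrite em el !eqxx.
Qed.

(** Each part contains exactly one pattern that is its own normal form, so [#|P|] of the six
    patterns are normal for either polarization. *)
Lemma count_bad (P : {set {set 'S_3}}) d : partition P [set: 'S_3] ->
  count (fun u => u != nf (part_of P) d u) (pats true) = (6 - #|P|)%N.
Proof.
move=> hP; have [/eqP hC hT hn] := and3P hP.
pose F := [set u : 'S_3 | word u == nf (part_of P) d (word u)].
have eF : #|F| = count (fun u => u == nf (part_of P) d u) (pats true).
  have pe : perm_eq [seq word u | u <- enum 'S_3] (pats true).
    apply: uniq_perm => //; first by rewrite (map_inj_uniq (@word_inj 3))
      enum_uniq.
    move=> u; apply/mapP/idP => [[w _ ->]|hu]; first exact: word_pats.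
    by exists (unword 3 u); rewrite ?mem_enum // unword_pats.
  rewrite -(seq.permP pe) count_map cardE size_filter -enumT.
  by apply: eq_count => u; rewrite !inE.
have -> : #|P| = #|F|.
  have -> : P = [set part_of P (word u) | u in F].
    apply/setP=> Q; apply/idP/imsetP => [QP|[u _ ->]]; last first.
      by rewrite pblock_mem // hC.
    have [u uQ] : exists u, u \in Q by apply/set0Pn; apply: contraNneq hn => <-.
    have hu := word_pats u; have hm := nf_mem (part_of P) d hu.
    have em := nf_cl (part_of P) d hu.
    exists (unword 3 (nf (part_of P) d (word u))).
      by rewrite inE unword_pats // (nf_eq d hm em).
    by rewrite unword_pats // em /part_of wordK (def_pblock hT QP uQ).
  apply: card_in_imset => u v; rewrite !inE => /eqP eu /eqP ev e.
  by apply: word_inj; rewrite eu ev; apply: nf_eq e; apply: word_pats.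
have /= <- := count_predC (fun u => u == nf (part_of P) d u) (pats true).
by rewrite eF addKn.
Qed.

(** * Equivalence classes as words without unstraightened hits *)

Lemma P_rearrangement_sym (P : {set {set 'S_3}}) n (w w' : 'S_n) :
  partition P [set: 'S_3] -> P_rearrangement P w w' -> P_rearrangement P w' w.
Proof.
move=> hP /existsP[i /(P_rearrangement_atP _ _ _ hP)[hw [v hv [ev ew]]]].
have [hs ps _] := hit_repl hw hv; have [_ hp] := andP hw.
apply/existsP; exists i; apply/P_rearrangement_atP => //; rewrite ew;
  split=> //.
exists (pat (word w) i) => //; rewrite ps; split=> //.
by rewrite repl_repl // repl_pat.
Qed.

(** Two words related by a rearrangement straighten at that position to the same word, as part and
    polarization agree. Conversely, straightening steps are rearrangements, which are reversible. *)
Lemma P_equivE (P : {set {set 'S_3}}) n (w w' : 'S_n) :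
  partition P [set: 'S_3] ->
  P_equiv P w w' =
  (nform (@straightening P (canonical_straightening P) n) w ==
   nform (@straightening P (canonical_straightening P) n) w').
Proof.
move=> hP; set e := @straightening P _ n.
have term : terminating e (fun x : 'S_n => potential n (word x)) :=
  straightening_terminating hP.
have lc : locally_confluent e := straightening_locally_confluent hP.
have step (x : 'S_n) i : hit (word x) i ->
    connect e x (unword n (straighten (part_of P) (word x) i)).
  move=> hx; have [_ hp] := andP hx.
  have hn : nf_at (part_of P) (word x) i \in pats true by apply: nf_mem.
  have [bx|nb] := boolP (bad (part_of P) (word x) i).
    apply/connect1/straighteningP => //; exists i; split=> //.
    exact: perm_repl_word.
  move: nb; rewrite /bad hx negbK => /eqP e1.
  by rewrite /straighten -e1 repl_pat // wordK connect0.
rewrite -(nform_sym term lc) /P_equiv; apply/idP/idP; apply: connect_sub => x y.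
  move=> /existsP[i /(P_rearrangement_atP _ _ _ hP)[hx [v hv [ev ey]]]].
  have [hs ps _] := hit_repl hx hv; have [_ hp] := andP hx.
  have hy : hit (word y) i by rewrite ey.
  have exy : straighten (part_of P) (word y) i = straighten (part_of P) (word x)
    i.
    rewrite /straighten /nf_at ey ps right_polarized_repl // repl_repl //;
      last exact: nf_mem.
    by rewrite (nf_eq _ hv ev).
  rewrite (nform_sym term lc) (nform_connect term lc (step x i hx)).
  by rewrite (nform_connect term lc (step y i hy)) exy.
have sub (a b : 'S_n) : e a b -> P_rearrangement P a b.
  by move=> /existsP[i /and4P[_ _ h _]]; apply/existsP; exists i.
case/orP=> /sub h; apply: connect1; first exact: h.
exact: P_rearrangement_sym.
Qed.

Lemma terminal_straightening (P : {set {set 'S_3}}) n (w : 'S_n) :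
  partition P [set: 'S_3] ->
  terminal (@straightening P (canonical_straightening P) n) w =
  all (fun i => ~~ bad (part_of P) (word w) i) (iota 0 (n - 2)).
Proof.
move=> hP; apply/forallP/allP => [hw i _|hw y].
  apply/negP => bi; have [hi _] := andP bi; have [_ hp] := andP hi.
  have /negP := hw (unword n (straighten (part_of P) (word w) i)); apply.
  apply/straighteningP => //; exists i; split=> //.
  by apply: perm_repl_word => //; apply: nf_mem.
apply/negP => /(straighteningP _ _ hP)[i [bi _]].
have [/andP[lt_i _] _] := andP bi; rewrite size_word in lt_i.
by have := hw i; rewrite bi mem_iota => /(_ _)/negP; apply; clear - lt_i; lia.
Qed.

(** The sieve identity is summed over all words and the sums are exchanged; the inner count depends
    on [J] only through its size. *)
Lemma card_terminal (P : {set {set 'S_3}}) n :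
  partition P [set: 'S_3] ->
  (forall d, ~~ ((part_of P (mid d) == part_of P (top d)) &&
                 (part_of P (low d) == part_of P (top d)))) ->
  #|[set w : 'S_n.+1 | all (fun i => ~~ bad (part_of P) (word w) i) (iota 0
    (n.+1 - 2))]|%:R =
  \sum_(0 <= j < n.+2 | (3 * j <= n.+1)%N)
     'C(n.+1 - 2 * j, j)%:R * ((-1) ^+ j * ((6 - #|P|) ^ j * (n.+1 - 2
       * j)`!)%:R) :> rat.
Proof.
move=> hP hB; rewrite -(sum_spaced (fun j => (-1) ^+ j * ((6 - #|P|) ^ j * (n.+1
  - 2 * j)`!)%:R)).
transitivity (\sum_(w : 'S_n.+1) \sum_(J <- spaced n.+1)
    (-1) ^+ size J * (all (bad (part_of P) (word w)) J)%:R : rat).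
  rewrite -sum1_card natr_sum big_mkcond; apply: eq_bigr => w _.
  rewrite -spaced_sieve; first by rewrite inE; case: all.
  by move=> i j lt_ij; apply: bad_apart lt_ij => //; apply: uniq_word.
rewrite exchange_big; apply: eq_big_seq => J hJ; have fJ := spaced_fits hJ.
rewrite -mulr_sumr -natr_sum -(card_bad (fun d => count_bad d hP) fJ).
by rewrite -sum1_card [in RHS]big_mkcond; congr (_ * _%:R);
  apply: eq_bigr => w _; rewrite inE; case: all.
Qed.

Theorem theorem3p1 (P : {set {set 'S_3}}) (hP : partition P [set: 'S_3]) :
  (exists C : {set 'S_3}, straightening_set P C /\ C_confluent P C) /\
  (~ (exists2 Q : {set 'S_3}, Q \in P &
        forall u : 'S_3,
          word u \in [:: [:: 1; 2; 3]; [:: 1; 3; 2]; [:: 2; 1; 3]]%N ->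
          u \in Q) ->
   ~ (exists2 Q : {set 'S_3}, Q \in P &
        forall u : 'S_3,
          word u \in [:: [:: 3; 2; 1]; [:: 3; 1; 2]; [:: 2; 3; 1]]%N ->
          u \in Q) ->
   forall n : nat, (3 <= n)%N ->
     (#|P_classes P n|)%:R =
     \sum_(0 <= j < n.+1 | (3 * j <= n)%N)
        ((-1) ^+ j * ((n - 2 * j)`!)%:R ^+ 2 * ((6 - #|P|)%N)%:R ^+ j)
        / ((j`!)%:R * ((n - 3 * j)`!)%:R) :> rat).
Proof.
split.
  exists (canonical_straightening P); split;
    first exact: canonical_straightening_set.
  by move=> n; apply: newman_confluent (straightening_terminating hP)
    (straightening_locally_confluent hP).
have [/eqP hC _ _] := and3P hP.
move=> hinc hdec [//|n] _.
have part_mem (u : 'S_3) Q : part_of P (word u) = Q -> u \in Q.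
  by move=> <-; rewrite /part_of wordK mem_pblock hC.
have hB d : ~~ ((part_of P (mid d) == part_of P (top d)) &&
                (part_of P (low d) == part_of P (top d))).
  apply/negP => /andP[/eqP em /eqP el]; case: d em el => em el;
    [apply: hinc|apply: hdec].
    exists (part_of P (top true)) => [|u]; first by rewrite pblock_mem // hC.
    by rewrite !inE => hu; apply: part_mem; case/or3P: hu => /eqP ->.
  exists (part_of P (top false)) => [|u]; first by rewrite pblock_mem // hC.
  by rewrite !inE => hu; apply: part_mem; case/or3P: hu => /eqP ->.
rewrite /P_classes (card_classes (straightening_terminating hP)); last first.
  by move=> x y; apply: P_equivE.
rewrite (eq_card (B := mem [set w : 'S_n.+1 | all (fun i => ~~ bad (part_of P)
  (word w) i) (iota 0 (n.+1 - 2))])); last first.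
  by move=> w; rewrite !in_set terminal_straightening.
rewrite card_terminal //; apply: eq_bigr => j le_j.
have fj : (j`!%:R : rat) != 0 by rewrite Num.Theory.pnatr_eq0 -lt0n fact_gt0.
have fnj : ((n.+1 - 3 * j)`!%:R : rat) != 0
  by rewrite Num.Theory.pnatr_eq0 -lt0n fact_gt0.
(* Eliminating the factorial of [n.+1 - 2 * j] in favour of the binomial coefficient makes both
   sides rational expressions in the same quantities. *)
have hb : ('C(n.+1 - 2 * j, j)%:R * (j`!%:R * (n.+1 - 3 * j)`!%:R) :
  rat) = (n.+1 - 2 * j)`!%:R.
  rewrite -!natrM -[in RHS](@bin_fact (n.+1 - 2 * j) j); last by clear - le_j;
    lia.
  by have -> : (n.+1 - 2 * j - j = n.+1 - 3 * j)%N by clear; lia.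
rewrite natrM natrX -hb.
move: fj fnj; move: (j`!%:R) ((n.+1 - 3 * j)`!%:R) => f g fj fnj.
by field; rewrite fj fnj.
Qed.
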